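(* Let $V_P=V_{\mathbb Z\alpha\oplus\mathbb Z_{\ge0}\beta}$ be the parabolic-type subVOA of the lattice VOA $V_{A_2}$. Then $O(V_P)$ is spanned by the following elements: \begin{itemize} \item $h(-n-2)u+h(-n-1)u$, for $u\in V_P$, $h\in\mathfrak h$, $n\ge 0$; \item $\gamma(-1)v+v$, for $v\in M_{\hat{\mathfrak h}}(1,\gamma)$, $\gamma\in\{\alpha,-\alpha,\beta,\alpha+\beta\}$; \item $\gamma(-1)^2v+\gamma(-1)v$, for $v\in M_{\hat{\mathfrak h}}(1,\gamma+\gamma')$, where $\gamma,\gamma'\in\{\alpha,-\alpha,\beta,\alpha+\beta\}$ and $\gamma+\gamma'\in\{\alpha+\beta,\beta\}$; \item all elements of $M_{\hat{\mathfrak h}}(1,m\alpha+n\beta)$, for $m\alpha+n\beta\in(\mathbb Z\alpha\oplus\mathbb Z_{\ge0}\beta)\setminus\{0,\alpha,-\alpha,\beta,\alpha+\beta\}$; \item $\alpha(-1)^3w-\alpha(-1)w$, for $w\in M_{\hat{\mathfrak h}}(1,0)$. \end{itemize}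
   Context: $A_2=\mathbb Z\alpha\oplus\mathbb Z\beta$ is the root lattice with $(\alpha|\alpha)=(\beta|\beta)=2$, $(\alpha|\beta)=-1$; $\mathfrak h=\mathbb C\otimes_{\mathbb Z}A_2$. $V_{A_2}=\bigoplus_{\gamma\in A_2}M_{\hat{\mathfrak h}}(1,\gamma)$ is the lattice VOA, where $M_{\hat{\mathfrak h}}(1,\gamma)$ is the level-one Heisenberg module spanned by $h^1(-n_1)\cdots h^r(-n_r)e^\gamma$ ($h^i\in\mathfrak h$, $n_i\ge1$), $e^0=\mathbf 1$, built with the bimultiplicative cocycle $\epsilon:A_2\times A_2\to\{\pm1\}$ given by $\epsilon(\alpha,\alpha)=\epsilon(\beta,\beta)=\epsilon(\alpha,\beta)=1$, $\epsilon(\beta,\alpha)=-1$. The field of $h(-1)\mathbf 1$ is $\sum_n h(n)z^{-n-1}$. For $P=\mathbb Z\alpha\oplus\mathbb Z_{\ge0}\beta\subset A_2$, $V_P=\bigoplus_{\gamma\in P}M_{\hat{\mathfrak h}}(1,\gamma)$, a subVOA with the same Virasoro element. For a VOA $V$, $O(V)=\mathrm{span}\{\mathrm{Res}_{z}Y(a,z)b\,\frac{(1+z)^{\mathrm{wt}\,a}}{z^2}: a,b\in V,\ a \text{ homogeneous}\}$; it is the subspace such that $A(V)=V/O(V)$ is the Zhu algebra. *)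

(* Defs.v *)
From mathcomp Require Import all_boot all_order all_algebra finmap multiset.
From mathcomp Require Import monalg.
From mathcomp Require Import boolp classical_sets functions cardinality fsbigop.
From mathcomp Require Import reals complex.

Set Implicit Arguments.
Unset Strict Implicit.
Unset Printing Implicit Defensive.
Import Order.TTheory GRing.Theory Num.Theory.
Local Open Scope classical_set_scope.
Local Open Scope ring_scope.

Definition lspan (K : numFieldType) (V : lmodType K) (X : set V) : set V :=
  [set v | exists (n : nat) (c : 'I_n -> K) (x : 'I_n -> V),
             (forall i, X (x i)) /\ v = \sum_(i < n) c i *: x i].

(* Sum of a sequence with finitely many nonzero terms (0 otherwise); used only
   for the locally finite sums that define the modes of fields. *)
Definition lfsum (V : nmodType) (f : nat -> V) : V :=
  \sum_(j \in [set: nat]) f j.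

(* A vertex operator algebra U is given as a subspace of V with the restricted products, [Y a n b] is
   a_(n) b, where Y(a,z) = \sum_n a_(n) z^(-n-1), and [om] is the Virasoro
   element; L(0) = om_(1). All conformal weights are assumed to be natural
   numbers, as is the case for V_P. *)
Section Zhu.
Context (K : numFieldType) (V : lmodType K) (Y : V -> int -> V -> V) (om : V).

Definition homogeneous (k : nat) (a : V) : Prop := Y om 1 a = k%:R *: a.

(* Res_z Y(a,z)b (1+z)^k / z^2 : the coefficient of z^(-1) picks a_(i-2) b from
   the summand 'C(k, i) z^(i-2). *)
Definition zhu_circ (k : nat) (a b : V) : V :=
  \sum_(i < k.+1) 'C(k, i)%:R *: Y a (i%:Z - 2) b.

Definition zhuO (U : set V) : set V :=
  lspan [set x | exists (k : nat) (a b : V),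
                  [/\ U a, homogeneous k a, U b & x = zhu_circ k a b]].
End Zhu.

(* (m, n) stands for m alpha + n beta. *)
Definition A2 : zmodType := (int * int)%type.

Definition alpha : A2 := (1, 0).
Definition beta : A2 := (0, 1).
Definition simple_root (i : bool) : A2 := if i then beta else alpha.

Definition A2form (g d : A2) : int :=
  2 * g.1 * d.1 - g.1 * d.2 - g.2 * d.1 + 2 * g.2 * d.2.

Section LatticeVOA.
Context (K : numFieldType).

(* Bimultiplicative, with value -1 on (beta, alpha) and 1 on (alpha, alpha),
   (beta, beta) and (alpha, beta). *)
Definition cocycle (g d : A2) : K := (-1) ^ (g.2 * d.1).

(* h = K (x) A_2, in the coordinates given by alpha and beta. *)
Definition cartan : lmodType K := (K^o * K^o)%type.

Definition toh (g : A2) : cartan := (g.1%:~R, g.2%:~R).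
Definition hcoord (h : cartan) (i : bool) : K := if i then h.2 else h.1.
Definition hform (h h' : cartan) : K :=
  \sum_(i : bool) \sum_(j : bool)
    hcoord h i * hcoord h' j * (A2form (simple_root i) (simple_root j))%:~R.

(* [modes]: monomials in the alpha(-n), beta(-n), n >= 1, as multisets; the pair
   (i, k) encodes (simple_root i)(-k-1). A basis element (m, g) of the lattice
   vertex algebra is the monomial m applied to e^g. *)
Definition modes : choiceType := {mset (bool * nat)%type}%mset.
Definition latbasis : choiceType := (modes * A2)%type.
Definition VA2 : lmodType K := {malg K[latbasis]}.

Definition bvec (m : modes) (g : A2) : VA2 := << (m, g) >>.
Definition evec (g : A2) : VA2 := bvec mset0 g.
Definition vac : VA2 := evec 0.

Definition linext (f : latbasis -> VA2) (v : VA2) : VA2 :=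
  \sum_(b <- msupp v) v@_b *: f b.

(* h(n): multiplication by h(n) for n < 0, the scalar (h | g) on M(1,g) for
   n = 0, and for n > 0 the derivation with
   h(n) . h'(-k) = n (h | h') \delta_(n, k). *)
Definition heis (h : cartan) (n : int) : VA2 -> VA2 :=
  linext (fun b : latbasis => let: (m, g) := b in
    match n with
    | Negz k => \sum_(i : bool) hcoord h i *: bvec ((i, k) +` m)%mset g
    | Posz 0 => hform h (toh g) *: bvec m g
    | Posz k.+1 =>
        \sum_(i : bool) (k.+1%:R * hform h (toh (simple_root i))
                         * (m (i, k))%:R) *: bvec (m `\ (i, k))%mset g
    end).

(* Coefficient of z^k in X(z)^r v, for X(z) = \sum_(j >= 1) x_j z^j / j. *)
Fixpoint pow_coef (x : nat -> VA2 -> VA2) (r k : nat) (v : VA2) : VA2 :=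
  if r is r'.+1 then
    \sum_(1 <= j < k.+1) j%:R^-1 *: x j (pow_coef x r' (k - j) v)
  else if k == 0%N then v else 0.

(* Coefficient of z^k in exp(X(z)) v; X(z)^r only has terms z^k with k >= r. *)
Definition exp_coef (x : nat -> VA2 -> VA2) (k : nat) (v : VA2) : VA2 :=
  \sum_(r < k.+1) r`!%:R^-1 *: pow_coef x r k v.

(* The mode (e^g)_(n) of
   Y(e^g, z) = exp(\sum_(j>=1) g(-j) z^j / j) exp(- \sum_(j>=1) g(j) z^-j / j)
               e_g z^g,
   with e_g e^d = cocycle(g, d) e^(g+d) and z^g e^d = z^(g|d) e^d. The term
   of degree l in z^-1 in the second factor meets the term of degree k in z of
   the first one, where k - l + (g | d) = - n - 1. *)
Definition emode (g : A2) (n : int) : VA2 -> VA2 :=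
  linext (fun b : latbasis => let: (m, d) := b in
    cocycle g d *: lfsum (fun l : nat =>
      if l%:Z - A2form g d - n - 1 is Posz k then
        exp_coef (fun j => heis (toh g) (- j%:Z)) k
          (exp_coef (fun j v => - heis (toh g) j%:Z v) l (bvec m (g + d)))
      else 0)).

(* Modes of the field of the monomial w applied to e^g, by iterated normally
   ordered products:
   Y(h(-k-1) a, z) = :(\partial^(k) h(z)) Y(a, z):, with
   \partial^(k) h(z) = \sum_(j >= 0) 'C(k+j, k) h(-k-1-j) z^j
                + (-1)^k \sum_(j >= 0) 'C(k+j, k) h(j) z^(-j-1-k). *)
Fixpoint word_mode (w : seq (bool * nat)) (g : A2) (n : int) (v : VA2) : VA2 :=
  if w is (i, k) :: w' then
    let h := toh (simple_root i) in
    lfsum (fun j : nat => 'C(k + j, k)%:R *: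
      (heis h (- (k + j).+1%:Z) (word_mode w' g (n + j%:Z) v)
       + (-1) ^+ k *: word_mode w' g (n - (k + j).+1%:Z) (heis h j%:Z v)))
  else emode g n v.

(* a_(n) b in V_(A_2). The factors of a monomial may be listed in any order, as
   the normally ordered products above do not depend on it. *)
Definition Ymode (a : VA2) (n : int) (b : VA2) : VA2 :=
  linext (fun x : latbasis => word_mode (enum_mset x.1) x.2 n b) a.

(* 1/2 \sum_i u_i(-1) u^i(-1) 1, for the basis alpha, beta of h and its dual
   basis (2 alpha + beta)/3, (alpha + 2 beta)/3. *)
Definition omega : VA2 :=
  2^-1 *: (heis (toh alpha) (-1) (heis (2 / 3, 1 / 3) (-1) vac)
           + heis (toh beta) (-1) (heis (1 / 3, 2 / 3) (-1) vac)).

(* M(1, g), the span of the monomials applied to e^g. *)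
Definition fock (g : A2) : set VA2 :=
  [set v | forall b, b \in msupp v -> b.2 = g].

Definition inP (g : A2) : Prop := 0 <= g.2.

Definition VP : set VA2 := [set v | forall b, b \in msupp v -> inP b.2].

End LatticeVOA.

Arguments VP K : clear implicits.

(* Main.v *)
Require Import Defs.
From HB Require Import structures.
From mathcomp Require Import all_boot all_order all_algebra finmap multiset.
From mathcomp Require Import monalg ring lra zify.
From mathcomp Require Import boolp classical_sets functions cardinality fsbigop.
From mathcomp Require Import reals complex.

Set Implicit Arguments.
Unset Strict Implicit.
Unset Printing Implicit Defensive.
Import Order.TTheory GRing.Theory Num.Theory.
Local Open Scope classical_set_scope.
Local Open Scope ring_scope.

(** Modulo the translation relations h(-n-2)u + h(-n-1)u, the operator h(-k-1)
    acts as (-1)^k h(-1). A monomial applied to e^c thus becomes, up to sign, a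
    product of coordinate functions on h*, and M(1,c) becomes a polynomial ring.
    The functional [chi c z] evaluates at the point z the polynomial of the
    M(1,c)-component; the common kernel of all of them in V_P is exactly the span
    of the translation relations ([O1_kernel]). Both inclusions are proved on
    these polynomials.

    The fields become simple there: the creation half of the k-th divided
    derivative of h(t) turns into (-1)^k h (1+t)^(-k-1), and the creation factor
    of Y(e^g,t) turns into (1+t)^g. Let q = (g|g)/2, and let a be a monomial
    applied to e^g and b in M(1,d). The weight of each factor of a that creates is
    absorbed by the exponent of 1+t, and the polynomial of a o b is a combination
    of binomial coefficients of g + q + N over N + l + 1 - (g|d), where N is the
    weight of the factors of a that annihilate and l the degree that they and
    Y(e^g,t) annihilate in b ([rho_cons], [rho_nil]).

    Products satisfy the relations: on M(1,c) the relations form the ideal of the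
    point set [zeros c], which is empty when they are everything. If c = g + d
    with g and d in P, then at every point of [zeros c] the root lattice element g
    takes an integer value a with 0 <= a + q <= -(g|d) ([zeros_bound]). Each of
    the binomial coefficients above then has an upper entry that is a natural
    number below the lower entry, so it vanishes ([rho_vanish], [circ_vanish]).
    Since L(0) is diagonal on the basis ([L0_bv]) this covers all homogeneous a.
    Division of polynomials shows that a vector of V_P killed by all [chi c z]
    with z in [zeros c] is in the span of the relations ([W_kernel]).

    Relations are products: translation relations are multiples of
    h(-n-1)1 o u ([circ_single]), and products with the vacuum give the multiples
    of g + 1 on M(1,g) ([root_rels_sub_O]). For the rest, let g be a root in P and
    h orthogonal to g. The products of e^g with h(-1)^k e^d and with
    g(-n-1) h(-1)^k e^d have polynomials h^k B(g) and h^k B(g) Q(g), where B(g) is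
    the binomial coefficient of g + 1 over 1 - (g|d) and Q has degree n + 1; they
    span all multiples of B ([inO_multiples]). The values -1 and -2 of (g|d) give
    the quadratic and cubic relations, the value 1 gives all of M(1,g+d), and for
    (g|d) >= 2 the second family alone has one polynomial in every degree
    ([inO_all]). *)

(** * The basis of the lattice vertex algebra *)

(** Sealed copies of [bvec] and [heis], which keep unification from unfolding
    vectors into finitely supported functions. *)
HB.lock Definition bv (K : numFieldType) (m : modes) (g : A2) : VA2 K := bvec K m g.

HB.lock Definition hs (K : numFieldType) (h : cartan K) (n : int) : VA2 K -> VA2 K :=
  heis h n.

Section LinearExtension.
Context (K : numFieldType) (W : lmodType K).
Implicit Types (f : latbasis -> W) (v : VA2 K).

(** [linext] with values in any module, so that it also provides functionals. *)
Definition lext f v : W := \sum_(b <- msupp v) v@_b *: f b.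

Lemma lextEw f v (d : {fset latbasis}) : (msupp v `<=` d)%fset ->
  lext f v = \sum_(b <- d) v@_b *: f b.
Proof.
move=> le; rewrite /lext (big_fset_incl _ le) //= => b _ bn.
by rewrite mcoeff_outdom // scale0r.
Qed.

Lemma lext_is_linear f : linear (lext f).
Proof.
move=> c u v; pose d := (msupp (c *: u + v) `|` (msupp u `|` msupp v))%fset.
rewrite (@lextEw f _ d) ?fsubsetUl //.
rewrite (@lextEw f u d); last by rewrite /d fsetUCA fsubsetUl.
rewrite (@lextEw f v d); last by rewrite /d fsetUA fsubsetUr.
rewrite scaler_sumr -big_split /=; apply: eq_bigr => b _.
rewrite scalerA -scalerDl.
by rewrite mcoeffD mcoeffZ.
Qed.
HB.instance Definition _ f :=
  GRing.isLinear.Build K (VA2 K) W *:%R (lext f) (lext_is_linear f).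

Lemma lextU f m g : lext f (bv K m g) = f (m, g).
Proof.
rewrite bv.unlock /lext /bvec msuppU oner_eq0 big_seq_fset1 mcoeffUU.
exact: scale1r.
Qed.

End LinearExtension.

Section Basis.
Context (K : numFieldType).
Implicit Types (u v w : VA2 K).
Local Notation V := (VA2 K).

Lemma mcoeff_bv m g x : (bv K m g)@_x = ((m, g) == x)%:R.
Proof.
rewrite bv.unlock.
by apply: (eq_trans (@mcoeffU latbasis K (m, g) 1 x)); case: eqP.
Qed.

Lemma VA2_basisE v : v = \sum_(b <- msupp v) v@_b *: bv K b.1 b.2.
Proof.
apply: etrans; first exact: (@monalgE latbasis K v).
apply: eq_bigr => b _; apply/malgP => x.
apply: (eq_trans (@mcoeffU latbasis K _ _ _)).
by rewrite mcoeffZ mcoeff_bv -surjective_pairing mulr_natr.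
Qed.

Lemma VA2_ind (P : V -> Prop) : P 0 -> (forall u v, P u -> P v -> P (u + v)) ->
  (forall c v, P v -> P (c *: v)) -> (forall m g, P (bv K m g)) -> forall v, P v.
Proof.
move=> P0 PD PZ Pb v; rewrite (VA2_basisE v).
by apply: (big_ind P) => // b _; exact: PZ.
Qed.

(** Fock spaces, [VP] and the weight filtration are all of this form, which gives
    them the same closure and induction lemmas. *)
Definition supported (S : latbasis -> Prop) : set V :=
  [set v | forall b, b \in msupp v -> S b].

Lemma supported_bv (S : latbasis -> Prop) m g : S (m, g) -> supported S (bv K m g).
Proof. by rewrite bv.unlock => Sb b; rewrite msuppU oner_eq0 inE => /eqP ->. Qed.

Lemma supported0 S : supported S 0.
Proof. by move=> b; rewrite msupp0 inE. Qed.

Lemma supportedD S u v : supported S u -> supported S v -> supported S (u + v).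
Proof.
by move=> fu fv b /(fsubsetP (msuppD_le u v)); rewrite inE => /orP[/fu|/fv].
Qed.

Lemma supportedZ S c v : supported S v -> supported S (c *: v).
Proof. by move=> fv b /(fsubsetP (msuppZ_le c v)) /fv. Qed.

Lemma supported_sum S I (r : seq I) (P : pred I) (F : I -> V) :
  (forall i, P i -> supported S (F i)) ->
  supported S (\sum_(i <- r | P i) F i).
Proof.
move=> fF; apply: (big_ind (supported S)) => //; first exact: supported0.
by move=> x y; exact: supportedD.
Qed.

Lemma supported_ind S (P : V -> Prop) : P 0 ->
  (forall u v, P u -> P v -> P (u + v)) -> (forall c v, P v -> P (c *: v)) ->
  (forall m g, S (m, g) -> P (bv K m g)) -> forall v, supported S v -> P v.
Proof.
move=> P0 PD PZ Pb v fv; rewrite (VA2_basisE v) big_seq_cond.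
apply: (big_ind P) => // b /andP[/fv Sb _]; apply: PZ; apply: Pb.
by rewrite -surjective_pairing.
Qed.

Lemma fock_bv m g : fock g (bv K m g).
Proof. exact: (@supported_bv (fun b => b.2 = g)). Qed.

Lemma fock0 g : fock g (0 : V).
Proof. exact: (@supported0 (fun b => b.2 = g)). Qed.

Lemma fockD g u v : fock g u -> fock g v -> fock g (u + v).
Proof. exact: (@supportedD (fun b => b.2 = g)). Qed.

Lemma fockZ g c v : fock g v -> fock g (c *: v).
Proof. exact: (@supportedZ (fun b => b.2 = g)). Qed.

Lemma fock_sum I (r : seq I) (P : pred I) (F : I -> V) g :
  (forall i, P i -> fock g (F i)) -> fock g (\sum_(i <- r | P i) F i).
Proof. exact: (@supported_sum (fun b => b.2 = g)). Qed.

Lemma fock_ind g (P : V -> Prop) : P 0 ->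
  (forall u v, P u -> P v -> P (u + v)) -> (forall c v, P v -> P (c *: v)) ->
  (forall m, P (bv K m g)) -> forall v, fock g v -> P v.
Proof.
move=> P0 PD PZ Pb; apply: (@supported_ind (fun b => b.2 = g)) => // m g' /= ->.
exact: Pb.
Qed.

Lemma VP_bv m g : inP g -> VP K (bv K m g).
Proof. exact: (@supported_bv (fun b => inP b.2)). Qed.

Lemma VP0 : VP K 0.
Proof. exact: (@supported0 (fun b => inP b.2)). Qed.

Lemma VPD u v : VP K u -> VP K v -> VP K (u + v).
Proof. exact: (@supportedD (fun b => inP b.2)). Qed.

Lemma VPZ c v : VP K v -> VP K (c *: v).
Proof. exact: (@supportedZ (fun b => inP b.2)). Qed.

Lemma VP_ind (P : V -> Prop) : P 0 ->
  (forall u v, P u -> P v -> P (u + v)) -> (forall c v, P v -> P (c *: v)) ->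
  (forall m g, inP g -> P (bv K m g)) -> forall v, VP K v -> P v.
Proof. exact: (@supported_ind (fun b => inP b.2)). Qed.

Lemma fock_VP g v : inP g -> fock g v -> VP K v.
Proof. by move=> gP fv b /fv ->. Qed.

End Basis.

(** * Spans and locally finite sums *)

Section Span.
Context (K : numFieldType) (V : lmodType K).
Implicit Types (X Y : set V).

Lemma lspan_gen X x : X x -> lspan X x.
Proof.
by move=> Xx; exists 1%N, (fun=> 1), (fun=> x); rewrite big_ord1 scale1r.
Qed.

Lemma lspan0 X : lspan X 0.
Proof.
by exists 0%N, (fun=> 0), (fun=> 0); split; [case|rewrite big_ord0].
Qed.

Lemma lspanZ X c x : lspan X x -> lspan X (c *: x).
Proof.
move=> [n [d [y [Xy ->]]]]; exists n, (fun i => c * d i), y; split=> //.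
by rewrite scaler_sumr; apply: eq_bigr => i _; rewrite scalerA.
Qed.

Lemma lspanD X x y : lspan X x -> lspan X y -> lspan X (x + y).
Proof.
move=> [m [c [a [Xa ->]]]] [n [d [b [Xb ->]]]].
exists (m + n)%N,
  (fun i : 'I_(m + n) =>
     match fintype.split i with inl j => c j | inr j => d j end),
  (fun i : 'I_(m + n) =>
     match fintype.split i with inl j => a j | inr j => b j end); split.
  by move=> i; case: fintype.split.
rewrite big_split_ord; congr (_ + _); apply: eq_bigr => i _.
  by rewrite (unsplitK (inl i)).
by rewrite (unsplitK (inr i)).
Qed.

Lemma lspanN X x : lspan X x -> lspan X (- x).
Proof. by move=> Xx; rewrite -scaleN1r; exact: lspanZ. Qed.

Lemma lspanB X x y : lspan X x -> lspan X y -> lspan X (x - y).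
Proof. by move=> Xx Xy; apply: lspanD => //; exact: lspanN. Qed.

Lemma lspan_sum X I (r : seq I) (P : pred I) (F : I -> V) :
  (forall i, P i -> lspan X (F i)) -> lspan X (\sum_(i <- r | P i) F i).
Proof.
move=> XF; apply: (big_ind (lspan X)) => //; first exact: lspan0.
by move=> x y; exact: lspanD.
Qed.

Lemma lspan_ind X (P : V -> Prop) : P 0 ->
  (forall x y, P x -> P y -> P (x + y)) -> (forall c x, P x -> P (c *: x)) ->
  (forall x, X x -> P x) -> forall x, lspan X x -> P x.
Proof.
move=> P0 PD PZ PX x [n [c [y [Xy ->]]]].
by apply: (big_ind P) => // i _; apply: PZ; apply: PX.
Qed.

End Span.

Section LocallyFinite.
Context (V : nmodType).

Lemma lfsumE (f : nat -> V) N : (forall j, (N <= j)%N -> f j = 0) ->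
  lfsum f = \sum_(j < N) f j.
Proof.
move=> f0; rewrite /lfsum -(fsbig_widen `I_N setT) //; first by rewrite fsbig_ord.
by move=> j [_ /= /negP]; rewrite -leqNgt => /f0.
Qed.

End LocallyFinite.

(** * The Heisenberg algebra *)

Section Heisenberg.
Context (K : numFieldType).
Implicit Types (u v w : VA2 K) (h : cartan K) (m : modes) (g : A2).
Local Notation V := (VA2 K).

Lemma hs_is_linear h n : linear (@hs K h n).
Proof. by rewrite hs.unlock; exact: lext_is_linear. Qed.
HB.instance Definition _ h n :=
  GRing.isLinear.Build K V V *:%R (@hs K h n) (hs_is_linear h n).

Lemma hs0 h n : hs h n 0 = 0 :> V. Proof. exact: linear0. Qed.
Lemma hsD h n u v : hs h n (u + v) = hs h n u + hs h n v.
Proof. exact: linearD. Qed.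
Lemma hsB h n u v : hs h n (u - v) = hs h n u - hs h n v.
Proof. exact: linearB. Qed.
Lemma hsN h n v : hs h n (- v) = - hs h n v.
Proof. exact: linearN. Qed.
Lemma hsZ h n c v : hs h n (c *: v) = c *: hs h n v.
Proof. exact: linearZ. Qed.
Lemma hs_sum h n I (r : seq I) (P : pred I) (F : I -> V) :
  hs h n (\sum_(i <- r | P i) F i) = \sum_(i <- r | P i) hs h n (F i).
Proof. exact: linear_sum. Qed.

Lemma hs_neg h k m g : hs h (Negz k) (bv K m g) =
  \sum_(i : bool) hcoord h i *: bv K ((i, k) +` m)%mset g.
Proof. by rewrite hs.unlock [LHS]lextU bv.unlock. Qed.

Lemma hs_zero h m g : hs h (Posz 0) (bv K m g) = hform h (toh K g) *: bv K m g.
Proof. by rewrite hs.unlock [LHS]lextU bv.unlock. Qed.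

Lemma hs_pos h k m g : hs h k.+1 (bv K m g) =
  \sum_(i : bool) (k.+1%:R * hform h (toh K (simple_root i)) * (m (i, k))%:R)
     *: bv K (m `\ (i, k))%mset g.
Proof. by rewrite hs.unlock [LHS]lextU bv.unlock. Qed.

Lemma hcoord_simple i j : hcoord (toh K (simple_root i)) j = (i == j)%:R.
Proof. by case: i; case: j. Qed.

Lemma hs_simple i k m g :
  hs (toh K (simple_root i)) (Negz k) (bv K m g) = bv K ((i, k) +` m)%mset g.
Proof.
rewrite hs_neg (bigD1 i) //= big1 ?addr0 => [|j /negPf ji].
  by rewrite hcoord_simple eqxx scale1r.
by rewrite hcoord_simple eq_sym ji scale0r.
Qed.

Lemma hsE h k v : hs h (Negz k) v =
  \sum_(i : bool) hcoord h i *: hs (toh K (simple_root i)) (Negz k) v.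
Proof.
move: v; apply: VA2_ind => [|u v eu ev|c v ev|m g].
- by rewrite hs0 big1 // => i _; rewrite hs0 scaler0.
- rewrite hsD eu ev -big_split; apply: eq_bigr => i _.
  by rewrite hsD scalerDr.
- rewrite hsZ ev scaler_sumr; apply: eq_bigr => i _.
  by rewrite hsZ !scalerA mulrC.
- by rewrite hs_neg; apply: eq_bigr => i _; rewrite hs_simple.
Qed.

Lemma modes_ind (P : modes -> Prop) : P mset0 ->
  (forall x m, P m -> P (x +` m)%mset) -> forall m, P m.
Proof.
move=> P0 PS m; rewrite -(seq_mset_id m); elim: (enum_mset m) => [|x s IHs].
  by have -> : seq_mset [::] = mset0 :> modes by apply/msetP => x; rewrite mset_seqE mset0E.
by rewrite mset_cons; exact: PS.
Qed.

Lemma enum_mset_cons x m : perm_eq (enum_mset (x +` m)%mset) (x :: enum_mset m).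
Proof.
by apply/eq_seq_msetP; rewrite mset_cons !seq_mset_id.
Qed.

Lemma fock_lin (f : {linear V -> V}) g g' :
  (forall m, fock g' (f (bv K m g))) -> forall v, fock g v -> fock g' (f v).
Proof.
move=> fb; apply: fock_ind => [|u v fu fv|c v fv|//].
- by rewrite linear0; exact: fock0.
- by rewrite linearD /=; exact: fockD.
- by rewrite linearZ; exact: fockZ.
Qed.

Lemma hs_fock h n g v : fock g v -> fock g (hs h n v).
Proof.
apply: (@fock_lin (hs h n)) => m /=; case: n => [[|k]|k].
- by rewrite hs_zero; apply: fockZ; exact: fock_bv.
- by rewrite hs_pos; apply: fock_sum => i _; apply: fockZ; exact: fock_bv.
- by rewrite hs_neg; apply: fock_sum => i _; apply: fockZ; exact: fock_bv.
Qed.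

Lemma hs_VP h n v : VP K v -> VP K (hs h n v).
Proof.
move: v; apply: VP_ind => [|u v fu fv|c v fv|m g gP].
- by rewrite hs0; exact: VP0.
- by rewrite hsD; exact: VPD.
- by rewrite linearZ; exact: VPZ.
- by apply: (fock_VP gP); apply: hs_fock; exact: fock_bv.
Qed.

Lemma hs_negC h h' k l v :
  hs h (Negz k) (hs h' (Negz l) v) = hs h' (Negz l) (hs h (Negz k) v).
Proof.
have ss i j u : hs (toh K (simple_root i)) (Negz k) (hs (toh K (simple_root j)) (Negz l) u)
  = hs (toh K (simple_root j)) (Negz l) (hs (toh K (simple_root i)) (Negz k) u).
  move: u; apply: VA2_ind => [|u u' eu eu'|c u eu|m g].
  - by rewrite !hs0.
  - by rewrite !hsD eu eu'.
  - by rewrite !hsZ eu.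
  - by rewrite !hs_simple msetDCA.
rewrite hsE [in RHS]hsE.
under eq_bigr => i _ do rewrite (hsE h') hs_sum scaler_sumr.
under [RHS]eq_bigr => i _ do rewrite (hsE h) hs_sum scaler_sumr.
rewrite [LHS]exchange_big; apply: eq_bigr => i _; apply: eq_bigr => j _.
by rewrite !hsZ ss !scalerA; congr (_ *: _); exact: mulrC.
Qed.

Lemma hformE h h' : hform h h' =
  \sum_(i : bool) hcoord h' i * hform h (toh K (simple_root i)).
Proof.
rewrite /hform !big_bool /= /hcoord /=; ring.
Qed.

Lemma A2form_simple i j :
  A2form (simple_root i) (simple_root j) = if i == j then 2 else - 1.
Proof. by case: i; case: j. Qed.

Lemma hform_toh g g' : hform (toh K g) (toh K g') = (A2form g g')%:~R.
Proof.
rewrite /hform !big_bool !A2form_simple /hcoord /A2form /toh.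
case: g g' => [a b] [c d]; rewrite /= !(rmorphD, rmorphN, rmorphM) /=.
ring.
Qed.

(** The relations [h(m), h'(-n)] = m (h|h') delta(m,n), checked on basis vectors,
    where h(m) acts as a derivation. *)
Lemma hs_comm h h' k l v :
  hs h k.+1 (hs h' (Negz l) v) = hs h' (Negz l) (hs h k.+1 v)
     + ((k == l)%:R * k.+1%:R * hform h h') *: v.
Proof.
have ss i u : hs h k.+1 (hs (toh K (simple_root i)) (Negz l) u)
  = hs (toh K (simple_root i)) (Negz l) (hs h k.+1 u)
  + ((k == l)%:R * k.+1%:R * hform h (toh K (simple_root i))) *: u.
  move: u; apply: VA2_ind => [|u v1 eu ev|c v1 ev|m g].
  - by rewrite !hs0 scaler0 addr0.
  - by rewrite !hsD eu ev scalerDr addrACA.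
  - by rewrite !hsZ ev scalerDr !scalerA (mulrC c).
  rewrite hs_simple !hs_pos hs_sum.
  (* Leibniz rule: the removed mode is either the one just added, or one of [m]. *)
  have E j : (k.+1%:R * hform h (toh K (simple_root j)) * (((i, l) +` m)%mset (j, k))%:R)
      *: bv K (((i, l) +` m) `\ (j, k))%mset g =
     (k.+1%:R * hform h (toh K (simple_root j)) * (m (j, k))%:R)
      *: bv K ((i, l) +` (m `\ (j, k)))%mset g
     + ((i == j) && (k == l))%:R *: ((k.+1%:R * hform h (toh K (simple_root i))) *: bv K m g).
    rewrite mset1DE xpair_eqE (eq_sym j).
    have [/andP[/eqP ij /eqP kl]|ne] := boolP (_ && _).
      subst; rewrite msetD1K natrD mulrDr scalerDl mulr1 scale1r [LHS]addrC.
      apply: (f_equal (fun x => x + _)).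
      have [m0|m0] := eqVneq (m (j, l)) 0%N; first by rewrite m0 mulr0 !scale0r.
      by rewrite msetB1K // -mset_neq0.
    rewrite add0n scale0r addr0; congr (_ *: bv K _ _).
    apply/msetP => x; rewrite msetB1E !mset1DE msetB1E.
    case: eqP => [->|]; case: eqP => [xx|] //=; rewrite ?subn0 //.
    by case: xx ne => <- <-; rewrite !eqxx.
  under eq_bigr => j _ do rewrite E.
  rewrite big_split /=; congr (_ + _).
    by apply: eq_bigr => j _; rewrite hsZ hs_simple.
  rewrite (bigD1 i) //= eqxx big1 ?addr0 => [|j /negPf ji].
    by rewrite scalerA mulrA.
  by rewrite eq_sym ji scale0r.
rewrite hsE hs_sum hformE mulr_sumr scaler_suml (hsE h') -big_split /=.
by apply: eq_bigr => i _; rewrite hsZ ss scalerDr scalerA mulrCA.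
Qed.

End Heisenberg.

(** * Binomial coefficients and exponential series *)

Section Binomials.
Context (K : numFieldType).
Implicit Types (x : K) (k n : nat).

(** The generalised binomial coefficient x(x-1)...(x-k+1)/k!. *)
Definition gb x k : K := (\prod_(i < k) (x - i%:R)) / k`!%:R.

Lemma gb0 x : gb x 0 = 1.
Proof. by rewrite /gb big_ord0 fact0 divr1. Qed.

Lemma gbS x k : k.+1%:R * gb x k.+1 = (x - k%:R) * gb x k.
Proof.
rewrite /gb big_ord_recr /= factS natrM.
have k0 : k.+1%:R != 0 :> K by rewrite pnatr_eq0.
have f0 : k`!%:R != 0 :> K by rewrite pnatr_eq0 -lt0n fact_gt0.
by move: k.+1%:R k`!%:R k0 f0 => a b a0 b0; field; rewrite a0 b0.
Qed.

Lemma gbD1 x k : gb (x + 1) k.+1 = gb x k.+1 + gb x k.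
Proof.
have E n : gb (x + 1) n.+1 = (x + 1) / n.+1%:R * gb x n.
  rewrite /gb big_ord_recl /= subr0 factS natrM.
  have -> : \prod_(i < n) (x + 1 - (bump 0 i)%:R) = \prod_(i < n) (x - i%:R).
    by apply: eq_bigr => i _; rewrite /bump leq0n add1n mulrS; ring.
  have k0 : n.+1%:R != 0 :> K by rewrite pnatr_eq0.
  have f0 : n`!%:R != 0 :> K by rewrite pnatr_eq0 -lt0n fact_gt0.
  by move: n.+1%:R n`!%:R k0 f0 => a b a0 b0; field; rewrite a0 b0.
have k0 : k.+1%:R != 0 :> K by rewrite pnatr_eq0.
have <- : (x - k%:R) / k.+1%:R * gb x k = gb x k.+1.
  by apply: (mulfI k0); rewrite gbS [LHS]mulrA; congr (_ * _); rewrite mulrC divfK.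
rewrite E -[X in _ = _ + X]mul1r -mulrDl; congr (_ * _).
by apply: (mulIf k0); rewrite [RHS]mulrDl !divfK // -natr1; ring.
Qed.

Lemma gb_nat n k : gb n%:R k = 'C(n, k)%:R.
Proof.
elim: n k => [|n IHn] [|k]; rewrite ?gb0 ?bin0 //.
  by rewrite /gb big_ord_recl subrr !mul0r bin0n.
by rewrite -natr1 gbD1 !IHn binS natrD.
Qed.

(** The recurrence says that the series E satisfies E' = a E / (1 + t), which
    characterises (1 + t)^a. The bound [M] allows for a truncated exponent. *)
Lemma gb_recurrence (a : K) (E : nat -> K) M : E 0%N = 1 ->
  (forall k, (k < M)%N ->
     k.+1%:R * E k.+1 = a * \sum_(j < k.+1) (-1) ^+ j * E (k - j)%N) ->
  forall k, (k <= M)%N -> E k = gb a k.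
Proof.
move=> E0 ES; elim=> [|k IHk] kM; first by rewrite gb0.
have k0 : k.+1%:R != 0 :> K by rewrite pnatr_eq0.
apply: (mulfI k0); rewrite gbS -IHk 1?ltnW // ES //.
case: k => [|k] in IHk kM k0 *; first by rewrite big_ord1 expr0 mul1r subr0.
rewrite big_ord_recl expr0 mul1r subn0 mulrDr.
have -> : \sum_(i < k.+1) (-1) ^+ lift ord0 i * E (k.+1 - lift ord0 i)%N =
   - \sum_(i < k.+1) (-1) ^+ i * E (k - i)%N.
  by rewrite -sumrN; apply: eq_bigr => i _; rewrite /= /bump leq0n add1n subSS exprS mulN1r mulNr.
by rewrite mulrN -ES 1?ltnW // mulrBl.
Qed.

End Binomials.

Section ExpSeries.
Context (K : numFieldType).
Local Notation V := (VA2 K).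

(** A functional sending every [x j] to a scalar turns the exponential series
    into the exponential of a power series over [K]. *)
Variables (x : nat -> V -> V) (phi : V -> K) (c : nat -> K).
Hypothesis phiZ : forall a v, phi (a *: v) = a * phi v.
Hypothesis phi_sum : forall n (F : nat -> V),
  phi (\sum_(1 <= j < n) F j) = \sum_(1 <= j < n) phi (F j).
Hypothesis phi0 : phi 0 = 0.
Hypothesis phix : forall j v, phi (x j.+1 v) = c j * phi v.

(** The exponent sum c_j t^(j+1) / (j+1), cut above degree [M] to be a
    polynomial. *)
Let ell M : {poly K} := \poly_(j < M.+1) (if j is i.+1 then c i / j%:R else 0).

Lemma phi_pow_coef M r k v : (k <= M)%N ->
  phi (pow_coef x r k v) = (ell M ^+ r)`_k * phi v.
Proof.
elim: r k => [|r IHr] k kM /=.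
  by rewrite expr0 coef1; case: eqP => _; rewrite ?mul1r ?phi0 ?mul0r.
rewrite phi_sum exprS coefM big_ord_recl coef_poly /= mul0r add0r.
rewrite big_add1 /= big_mkord mulr_suml; apply: eq_bigr => j _.
rewrite phiZ phix IHr; last by rewrite (leq_trans (leq_subr _ _)).
rewrite coef_poly /= /bump leq0n add1n ltnS (leq_trans (ltn_ord j)) //.
by rewrite !mulrA (mulrC _ (c j)).
Qed.

Lemma ell_pow0 M r k : (k < r)%N -> (ell M ^+ r)`_k = 0.
Proof.
elim: r k => // r IHr k kr; rewrite exprS coefM big_ord_recl coef_poly /= mul0r add0r.
apply: big1 => j _; rewrite IHr ?mulr0 //.
by have := ltn_ord j; rewrite /= /bump; lia.
Qed.

Definition exp_scalar M k : K := \sum_(r < M.+1) r`!%:R^-1 * (ell M ^+ r)`_k.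

Lemma phi_exp_coef_ell M k v : (k <= M)%N ->
  phi (exp_coef x k v) = exp_scalar M k * phi v.
Proof.
move=> kM; rewrite /exp_coef /exp_scalar.
have phiS n (F : nat -> V) : phi (\sum_(j < n) F j) = \sum_(j < n) phi (F j).
  have := phi_sum n.+1 (F \o predn); rewrite !big_add1 /= !big_mkord //.
pose F r := r`!%:R^-1 *: pow_coef x r k v.
rewrite (phiS _ F) (big_ord_widen M.+1 (fun r => phi (F r))) ?ltnS // /F.
rewrite big_mkcond mulr_suml; apply: eq_bigr => r _; rewrite phiZ (@phi_pow_coef M) //.
case: ltnP => kr; first by rewrite mulrA.
by rewrite ell_pow0 ?mulr0 ?mul0r.
Qed.

Lemma exp_scalar0 M : exp_scalar M 0 = 1.
Proof.
rewrite /exp_scalar big_ord_recl /= fact0 expr0 coef1 invr1 mul1r.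
by rewrite big1 ?addr0 // => r _; rewrite ell_pow0 ?mulr0.
Qed.

(** The equation E' = L' E for the exponential E of L, coefficient by
    coefficient. *)
Lemma exp_scalarS M k : (k < M)%N ->
  k.+1%:R * exp_scalar M k.+1 = \sum_(j < k.+1) c j * exp_scalar M (k - j).
Proof.
move=> kM; rewrite /exp_scalar big_ord_recl /= expr0 coef1 mulr0 add0r.
have term r : k.+1%:R * ((r.+1)`!%:R^-1 * (ell M ^+ r.+1)`_k.+1) =
    \sum_(j < k.+1) c j * (r`!%:R^-1 * (ell M ^+ r)`_(k - j)).
  have -> : k.+1%:R * ((r.+1)`!%:R^-1 * (ell M ^+ r.+1)`_k.+1) =
      (r.+1)`!%:R^-1 * ((ell M ^+ r.+1)^`())`_k by rewrite coef_deriv mulrCA mulr_natl.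
  rewrite deriv_exp coefMn -[X in _ * X = _]mulr_natl factS natrM coefM !mulr_sumr.
  apply: eq_bigr => j _.
  rewrite coef_deriv coef_poly ltnS (leq_trans (ltn_ord j)) //=.
  rewrite -[X in _ * (_ * (X * _))]mulr_natr divfK ?pnatr_eq0 //.
  have k0 : r.+1%:R != 0 :> K by rewrite pnatr_eq0.
  have f0 : r`!%:R != 0 :> K by rewrite pnatr_eq0 -lt0n fact_gt0.
  by move: r.+1%:R r`!%:R k0 f0 => a b a0 b0; field; rewrite a0 b0.
rewrite mulr_sumr (eq_bigr (fun r : 'I_M => \sum_(j < k.+1)
  c j * (r`!%:R^-1 * (ell M ^+ r)`_(k - j)))); last by move=> r _; exact: term.
rewrite exchange_big /=.
apply: eq_bigr => j _; rewrite -mulr_sumr; congr (_ * _).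
rewrite [RHS]big_ord_recr /= ell_pow0 ?mulr0 ?addr0 //.
exact: leq_ltn_trans (leq_subr _ _) kM.
Qed.

End ExpSeries.

(** * Evaluation functionals *)

(** The polynomial attached to a monomial on e^g is the product of the
    (-1)^k alpha and (-1)^k beta over its factors alpha(-k-1) and beta(-k-1);
    [z false] and [z true] are the values of alpha and beta. *)
HB.lock Definition chi (K : numFieldType) (g : A2) (z : bool -> K) (v : VA2 K) : K :=
  lext (W := K^o) (fun b => if b.2 == g then
    \prod_(x <- enum_mset b.1) ((-1) ^+ x.2 * z x.1) else 0) v.

Section Functionals.
Context (K : numFieldType).
Implicit Types (u v w : VA2 K) (h : cartan K) (m : modes) (g : A2) (z : bool -> K).
Local Notation V := (VA2 K).

Lemma chi_lin g z : linear (chi g z : V -> K^o).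
Proof. by rewrite chi.unlock; exact: lext_is_linear. Qed.
HB.instance Definition _ g z :=
  GRing.isLinear.Build K V K^o *:%R (@chi K g z) (@chi_lin g z).

Lemma chi0 g z : chi g z 0 = 0 :> K. Proof. exact: linear0. Qed.
Lemma chiD g z u v : chi g z (u + v) = chi g z u + chi g z v.
Proof. exact: linearD. Qed.
Lemma chiB g z u v : chi g z (u - v) = chi g z u - chi g z v.
Proof. exact: linearB. Qed.
Lemma chiZ g z c v : chi g z (c *: v) = c * chi g z v.
Proof. exact: linearZ. Qed.
Lemma chi_sum g z I (r : seq I) (P : pred I) (F : I -> V) :
  chi g z (\sum_(i <- r | P i) F i) = \sum_(i <- r | P i) chi g z (F i).
Proof. exact: linear_sum. Qed.

Lemma chi_bv g z m g' : chi g z (bv K m g') =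
  if g' == g then \prod_(x <- enum_mset m) ((-1) ^+ x.2 * z x.1) else 0.
Proof. by rewrite chi.unlock [LHS]lextU. Qed.

Lemma chi_vac g z : chi g z (bv K mset0 g) = 1.
Proof. by rewrite chi_bv eqxx enum_mset0 big_nil. Qed.

Lemma chi_fock g g' z v : fock g' v -> g' != g -> chi g z v = 0.
Proof.
move=> fv /negPf gg; move: v fv; apply: fock_ind => [|u v eu ev|c v ev|m].
- exact: chi0.
- by rewrite chiD eu ev addr0.
- by rewrite chiZ ev mulr0.
- by rewrite chi_bv gg.
Qed.

(** The value at [z] of the linear polynomial on [h*] given by [h]. *)
Definition zv z h : K := \sum_(i : bool) hcoord h i * z i.

Lemma chi_neg g z h k v :
  chi g z (hs h (Negz k) v) = (-1) ^+ k * zv z h * chi g z v.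
Proof.
move: v; apply: VA2_ind => [|u v eu ev|c v ev|m g'].
- by rewrite hs0 chi0 mulr0.
- by rewrite hsD !chiD eu ev mulrDr.
- by rewrite hsZ !chiZ ev mulrCA.
rewrite hs_neg chi_sum chi_bv /zv mulr_sumr mulr_suml; apply: eq_bigr => i _.
rewrite chiZ chi_bv; case: eqP => _; last by rewrite !mulr0.
rewrite (perm_big _ (enum_mset_cons _ _)) big_cons /=.
by rewrite !mulrA (mulrC (hcoord _ _)).
Qed.

(** As h(-j) becomes (-1)^(j-1) h, the exponent sum h(-j) t^j / j becomes
    h log(1+t). *)
Lemma chi_exp_creation g z h k v :
  chi g z (exp_coef (fun j => hs h (- j%:Z)) k v) = gb (zv z h) k * chi g z v.
Proof.
pose c j : K := (-1) ^+ j * zv z h.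
have H : forall j v, chi g z (hs h (- j.+1%:Z) v) = c j * chi g z v.
  by move=> j u; rewrite -NegzE chi_neg.
rewrite (@phi_exp_coef_ell _ (fun j => hs h (- j%:Z)) _ c _ _ _ H k) //; last first.
- exact: chi0.
- by move=> n F; exact: chi_sum.
- exact: chiZ.
congr (_ * _); apply: (gb_recurrence (M := k)) => // [|j jk]; first exact: exp_scalar0.
rewrite exp_scalarS // mulr_sumr; apply: eq_bigr => i _; rewrite /c; ring.
Qed.

End Functionals.

(** * Modes of the lattice operators *)

(** Sealed for the same reason as [bv] and [hs]. *)
HB.lock Definition em (K : numFieldType) (g : A2) (n : int) : VA2 K -> VA2 K :=
  emode g n.

HB.lock Definition wmode (K : numFieldType) (w : seq (bool * nat)) (g : A2) (n : int)
  : VA2 K -> VA2 K := word_mode w g n.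

Section ExpOperators.
Context (K : numFieldType).
Local Notation V := (VA2 K).
Variable (x : nat -> V -> V).

Lemma exp_coef0 v : exp_coef x 0 v = v.
Proof. by rewrite /exp_coef big_ord1 /= invr1 scale1r. Qed.

Lemma pow_coef_closed (P : V -> Prop) : P 0 ->
  (forall u v, P u -> P v -> P (u + v)) -> (forall c v, P v -> P (c *: v)) ->
  (forall j v, P v -> P (x j.+1 v)) ->
  forall r k v, P v -> P (pow_coef x r k v).
Proof.
move=> P0 PD PZ Px; elim=> [|r IHr] k v Pv /=; first by case: eqP.
rewrite big_add1 /= big_mkord; apply: (big_ind P) => // j _.
by apply: PZ; apply: Px; exact: IHr.
Qed.

Lemma exp_coef_closed (P : V -> Prop) : P 0 ->
  (forall u v, P u -> P v -> P (u + v)) -> (forall c v, P v -> P (c *: v)) ->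
  (forall j v, P v -> P (x j.+1 v)) ->
  forall k v, P v -> P (exp_coef x k v).
Proof.
move=> P0 PD PZ Px k v Pv; apply: (big_ind P) => // r _.
by apply: (PZ); exact: (pow_coef_closed P0 PD PZ Px).
Qed.

Hypothesis xlin : forall j c u v, x j (c *: u + v) = c *: x j u + x j v.

Lemma pow_coef_lin r k c u v :
  pow_coef x r k (c *: u + v) = c *: pow_coef x r k u + pow_coef x r k v.
Proof.
elim: r k => [|r IHr] k /=; first by case: eqP; rewrite ?scaler0 ?addr0.
rewrite scaler_sumr -big_split; apply: eq_bigr => j _ /=.
by rewrite IHr xlin scalerDr !scalerA (mulrC c).
Qed.

Lemma exp_coef_lin k c u v :
  exp_coef x k (c *: u + v) = c *: exp_coef x k u + exp_coef x k v.
Proof.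
rewrite /exp_coef scaler_sumr -big_split; apply: eq_bigr => j _ /=.
by rewrite pow_coef_lin scalerDr !scalerA (mulrC c).
Qed.

(** With the weight filtration this bounds the annihilation degrees that
    contribute to a mode. *)
Lemma pow_coef_filtration (F : nat -> V -> Prop) :
  (forall n, F n 0) -> (forall n u v, F n u -> F n v -> F n (u + v)) ->
  (forall n c v, F n v -> F n (c *: v)) ->
  (forall j n v, F n v -> F (n - j)%N (x j v)) ->
  forall r k n v, F n v -> F (n - k)%N (pow_coef x r k v).
Proof.
move=> F0 FD FZ Fx; elim=> [|r IHr] k n v Fv /=.
  by case: eqP => [->|]; rewrite ?subn0.
rewrite big_seq_cond; apply: (big_ind (F _)) => //; first exact: FD.
move=> j; rewrite andbT mem_index_iota ltnS => /andP[j0 jk]; apply: FZ.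
have -> : (n - k = n - (k - j) - j)%N by rewrite -subnDA subnK.
by apply: Fx; exact: IHr.
Qed.

Lemma exp_coef_filtration (F : nat -> V -> Prop) :
  (forall n, F n 0) -> (forall n u v, F n u -> F n v -> F n (u + v)) ->
  (forall n c v, F n v -> F n (c *: v)) ->
  (forall j n v, F n v -> F (n - j)%N (x j v)) ->
  forall k n v, F n v -> F (n - k)%N (exp_coef x k v).
Proof.
move=> F0 FD FZ Fx k n v Fv; apply: (big_ind (F _)) => // [u u1|r _]; first exact: FD.
by apply: (FZ); exact: (pow_coef_filtration F0 FD FZ Fx).
Qed.

End ExpOperators.

Section Lowering.
Context (K : numFieldType).
Implicit Types (u v : VA2 K) (h : cartan K) (m : modes) (g d : A2).
Local Notation V := (VA2 K).

Definition word_wt (w : seq (bool * nat)) : nat := \sum_(x <- w) x.2.+1.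
Definition mode_wt m : nat := word_wt (enum_mset m).

Lemma mode_wt_cons x m : mode_wt (x +` m)%mset = (x.2.+1 + mode_wt m)%N.
Proof. by rewrite /mode_wt /word_wt (perm_big _ (enum_mset_cons _ _)) big_cons. Qed.

(** The inequality is strict so that [low 0] is zero, and a vector that is lowered
    often enough vanishes. *)
Definition low (n : nat) : set V := supported (fun b => (mode_wt b.1 < n)%N).

Lemma low_mono n n' v : (n <= n')%N -> low n v -> low n' v.
Proof. by move=> nn lv b /lv lb; exact: leq_trans nn. Qed.

Lemma low0 v : low 0 v -> v = 0.
Proof.
move: v; apply: supported_ind => // [u v -> ->|c v ->]; first by rewrite addr0.
by rewrite scaler0.
Qed.

Lemma low_exists v : exists n, low n v.
Proof.
move: v; apply: VA2_ind => [|u v [n ln] [n' ln']|c v [n ln]|m g].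
- by exists 0%N; exact: supported0.
- exists (maxn n n'); apply: supportedD; first exact: low_mono (leq_maxl _ _) ln.
  exact: low_mono (leq_maxr _ _) ln'.
- by exists n; exact: supportedZ.
- by exists (mode_wt m).+1; apply: supported_bv => /=.
Qed.

Lemma hs_low h j n v : low n v -> low (n - j)%N (hs h j v).
Proof.
move: v; apply: supported_ind => [|u v lu lv|c v lv|m g /= mn].
- by rewrite hs0; exact: supported0.
- by rewrite hsD; exact: supportedD.
- by rewrite hsZ; exact: supportedZ.
case: j => [|k].
  by rewrite hs_zero; apply: supportedZ; apply: supported_bv; rewrite /= subn0.
rewrite hs_pos; apply: supported_sum => i _.
have [m0|m0] := eqVneq (m (i, k)) 0%N.
  by rewrite m0 mulr0 scale0r; exact: supported0.
apply: supportedZ; apply: supported_bv => /=.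
have im := m0; rewrite mset_neq0 in im.
by move: mn; rewrite -{1}(msetB1K im) mode_wt_cons /=; lia.
Qed.

Lemma hs_trunc h v : exists n, forall j, (n <= j)%N -> hs h (Posz j) v = 0.
Proof.
have [n ln] := low_exists v; exists n => j nj.
by apply: low0; have := @hs_low h j n v ln; move: nj; rewrite -subn_eq0 => /eqP ->.
Qed.

(** The annihilation factor of the vertex operator of [e^g]. *)
Definition ann g (l : nat) : V -> V :=
  exp_coef (fun j v => - hs (toh K g) j%:Z v) l.

Lemma ann_lin g l c u v : ann g l (c *: u + v) = c *: ann g l u + ann g l v.
Proof.
apply: exp_coef_lin => j b x y; rewrite hsD hsZ opprD scalerN //.
Qed.

Lemma ann_low g l n v : low n v -> low (n - l)%N (ann g l v).
Proof.
apply: (exp_coef_filtration (F := low)) => [k|k a b|k c w|j k w lw].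
- exact: supported0.
- exact: supportedD.
- exact: supportedZ.
- by rewrite -scaleN1r; apply: supportedZ; exact: hs_low.
Qed.

Lemma ann_trunc g v : exists n, forall l, (n <= l)%N -> ann g l v = 0.
Proof.
have [n ln] := low_exists v; exists n => j nj.
by apply: low0; have := @ann_low g j n v ln; move: nj; rewrite -subn_eq0 => /eqP ->.
Qed.

Lemma ann_fock g l d v : fock d v -> fock d (ann g l v).
Proof.
apply: exp_coef_closed => [|a b|c w|j w fw].
- exact: fock0.
- exact: fockD.
- exact: fockZ.
- by rewrite -scaleN1r; apply: fockZ; exact: hs_fock.
Qed.

Lemma ann0 g l : ann g l 0 = 0.
Proof. by have := ann_lin g l (-1) 0 0; rewrite !scaleN1r !addNr. Qed.

(** Multiplication by [e^g] without the cocycle. *)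
Definition shift g : V -> V := lext (fun b => bv K b.1 (g + b.2)).

Lemma shift_bv g m d : shift g (bv K m d) = bv K m (g + d).
Proof. exact: lextU. Qed.
Lemma shift0 g : shift g 0 = 0. Proof. exact: linear0. Qed.
Lemma shiftD g u v : shift g (u + v) = shift g u + shift g v.
Proof. exact: linearD. Qed.
Lemma shiftZ g c v : shift g (c *: v) = c *: shift g v.
Proof. exact: linearZ. Qed.

Lemma shift_fock g d v : fock d v -> fock (g + d) (shift g v).
Proof.
move: v; apply: fock_ind => [|u v fu fv|c v fv|m].
- by rewrite shift0; exact: fock0.
- by rewrite shiftD; exact: fockD.
- by rewrite shiftZ; exact: fockZ.
- by rewrite shift_bv; exact: fock_bv.
Qed.

Lemma shift_neg g h k v : shift g (hs h (Negz k) v) = hs h (Negz k) (shift g v).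
Proof.
move: v; apply: VA2_ind => [|u v eu ev|c v ev|m d].
- by rewrite !(shift0, hs0).
- by rewrite !(shiftD, hsD) eu ev.
- by rewrite !(shiftZ, hsZ) ev.
rewrite shift_bv !hs_neg [LHS]linear_sum; apply: eq_bigr => i _.
by rewrite linearZ /= -[lext _ _]/(shift g _) shift_bv.
Qed.

End Lowering.

Section LfsumLinear.
Context (K : numFieldType) (V : lmodType K).

Lemma lfsum_lin (c : K) (f f' : nat -> V) :
  (exists n, forall j, (n <= j)%N -> f j = 0) ->
  (exists n, forall j, (n <= j)%N -> f' j = 0) ->
  lfsum (fun j => c *: f j + f' j) = c *: lfsum f + lfsum f'.
Proof.
move=> [n fn] [n' fn'].
rewrite (lfsumE (N := maxn n n')) => [|j]; last first.
  by rewrite geq_max => /andP[nj nj']; rewrite fn // fn' // scaler0 addr0.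
rewrite (lfsumE (f := f) (N := maxn n n')) => [|j]; last first.
  by rewrite geq_max => /andP[nj _]; exact: fn.
rewrite (lfsumE (f := f') (N := maxn n n')) => [|j]; last first.
  by rewrite geq_max => /andP[_ nj]; exact: fn'.
by rewrite scaler_sumr -big_split.
Qed.

End LfsumLinear.

Section VertexOperators.
Context (K : numFieldType).
Implicit Types (u v : VA2 K) (h : cartan K) (m : modes) (g d : A2) (z : bool -> K).
Local Notation V := (VA2 K).

(** The summand of annihilation degree [l] in [emode]. *)
Definition em_term g d (n : int) v (l : nat) : V :=
  if l%:Z - A2form g d - n - 1 is Posz k then
    exp_coef (fun j => hs (toh K g) (- j%:Z)) k (ann g l (shift g v))
  else 0.

Lemma em_lin g n : linear (@em K g n).
Proof. by rewrite em.unlock; exact: lext_is_linear. Qed.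
HB.instance Definition _ g n :=
  GRing.isLinear.Build K V V *:%R (@em K g n) (@em_lin g n).

Lemma em_bv g n m d : em g n (bv K m d) = cocycle K g d *: lfsum (em_term g d n (bv K m d)).
Proof.
rewrite em.unlock [LHS]lextU.
apply: (f_equal (fun f => cocycle K g d *: lfsum f)); apply/funext => l.
by rewrite /em_term /ann shift_bv hs.unlock bv.unlock.
Qed.

Lemma creation_lin g k c u v :
  exp_coef (fun j => hs (toh K g) (- j%:Z)) k (c *: u + v) =
  c *: exp_coef (fun j => hs (toh K g) (- j%:Z)) k u
  + exp_coef (fun j => hs (toh K g) (- j%:Z)) k v.
Proof. by apply: exp_coef_lin => j a x y; rewrite hsD hsZ. Qed.

Lemma creation_fock g k d v : fock d v ->
  fock d (exp_coef (fun j => hs (toh K g) (- j%:Z)) k v).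
Proof.
apply: exp_coef_closed => [|a b|c w|j w].
- exact: fock0.
- exact: fockD.
- exact: fockZ.
- exact: hs_fock.
Qed.

Lemma creation0 g k : exp_coef (fun j => hs (toh K g) (- j%:Z)) k 0 = 0 :> V.
Proof. by have := creation_lin g k (-1) 0 0; rewrite !scaleN1r !addNr. Qed.

Lemma em_term_lin g d n c u v l :
  em_term g d n (c *: u + v) l = c *: em_term g d n u l + em_term g d n v l.
Proof.
rewrite /em_term shiftD shiftZ ann_lin.
by case: (_ - 1) => k; rewrite ?creation_lin // scaler0 addr0.
Qed.

Lemma em_term_trunc g d n v l : ann g l (shift g v) = 0 -> em_term g d n v l = 0.
Proof. by rewrite /em_term => ->; case: (_ - 1) => k //; rewrite creation0. Qed.

Lemma em_term_finite g d n v :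
  exists N, forall l, (N <= l)%N -> em_term g d n v l = 0.
Proof.
have [N annN] := ann_trunc g (shift g v); exists N => l Nl.
by apply: em_term_trunc; exact: annN.
Qed.

Lemma em_fockE g d n v : fock d v -> em g n v = cocycle K g d *: lfsum (em_term g d n v).
Proof.
move: v; apply: fock_ind => [|u v eu ev|c v ev|m]; last exact: em_bv.
- rewrite linear0 (lfsumE (N := 0)) ?big_ord0 ?scaler0 // => l _.
  by apply: em_term_trunc; rewrite shift0 ann0.
- rewrite linearD /= eu ev -scalerDr; congr (_ *: _).
  rewrite -[X in X + _]scale1r -lfsum_lin; try exact: em_term_finite.
  by congr lfsum; apply/funext => l; rewrite -em_term_lin scale1r.
- rewrite linearZ /= ev scalerA mulrC -scalerA; congr (_ *: _).
  have f0 : exists N, forall l, (N <= l)%N -> (fun=> 0 : V) l = 0 by exists 0%N.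
  have z0 : lfsum (fun=> 0 : V) = 0 by rewrite (lfsumE (N := 0)) ?big_ord0.
  rewrite -[LHS]addr0 -z0 -lfsum_lin //; last exact: em_term_finite.
  congr lfsum; apply/funext => l; rewrite -[in RHS](addr0 (c *: v)) em_term_lin.
  by congr (_ + _); rewrite em_term_trunc // shift0 ann0.
Qed.

Lemma em_fock g d n v : fock d v -> fock (g + d) (em g n v).
Proof.
move=> fv; rewrite (em_fockE _ _ fv); have [N tN] := em_term_finite g d n v.
rewrite (lfsumE tN); apply: fockZ; apply: fock_sum => l _.
rewrite /em_term; case: (_ - 1) => k; last exact: fock0.
by apply: creation_fock; apply: ann_fock; exact: shift_fock.
Qed.

Lemma em_trunc g v : exists N : nat, forall n : int, N%:Z <= n -> em g n v = 0.
Proof.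
move: v; apply: VA2_ind => [|u v [N eu] [N' ev]|c v [N ev]|m d].
- by exists 0%N => n _; rewrite linear0.
- exists (maxn N N') => n nN.
  rewrite linearD /= eu ?ev ?addr0 //; lia.
- by exists N => n nN; rewrite linearZ /= ev // scaler0.
have [N annN] := ann_trunc g (bv K m (g + d)).
exists (N + `|A2form g d|)%N => n nN; rewrite em_bv (lfsumE (N := N)); last first.
  by move=> l Nl; apply: em_term_trunc; rewrite shift_bv annN.
rewrite big1 ?scaler0 // => l _; rewrite /em_term.
have : l%:Z - A2form g d - n - 1 < 0 by have := ltn_ord l; lia.
by case: (_ - 1).
Qed.

End VertexOperators.

(** * Modes of normally ordered products *)

Lemma scaler_lin2 (K : comRingType) (V : lmodType K) (a b c : K) (x x' y y' : V) :
  a *: ((c *: x + x') + b *: (c *: y + y')) =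
  c *: (a *: (x + b *: y)) + a *: (x' + b *: y').
Proof.
by rewrite !scalerDr !scalerA addrACA; congr (_ *: _ + _ *: _ + _); ring.
Qed.

Section WordModes.
Context (K : numFieldType).
Implicit Types (u v : VA2 K) (h : cartan K) (m : modes) (g d : A2) (z : bool -> K).
Implicit Types (w : seq (bool * nat)) (n : int) (x : bool * nat).
Local Notation V := (VA2 K).

(** The summand of index [j] in [word_mode], with the creation half of the first
    factor outside and its annihilation half inside. *)
Definition wmode_term x w g n v (j : nat) : V :=
  'C(x.2 + j, x.2)%:R *:
      (hs (toh K (simple_root x.1)) (Negz (x.2 + j)) (wmode w g (n + j%:Z) v)
       + (-1) ^+ x.2 *: wmode w g (n - (x.2 + j).+1%:Z)
           (hs (toh K (simple_root x.1)) j%:Z v)).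

Lemma wmode_nil g n v : wmode [::] g n v = em g n v.
Proof. by rewrite wmode.unlock em.unlock. Qed.

Lemma wmode_cons x w g n v : wmode (x :: w) g n v = lfsum (wmode_term x w g n v).
Proof. by rewrite wmode.unlock /wmode_term wmode.unlock hs.unlock; case: x. Qed.

Lemma wmode_term_trunc x w g n v J : (forall n, wmode w g n 0 = 0 :> V) ->
  (forall j, (J <= j)%N -> hs (toh K (simple_root x.1)) (Posz j) v = 0) ->
  (forall j, (J <= j)%N -> wmode w g (n + j%:Z) v = 0) ->
  forall j, (J <= j)%N -> wmode_term x w g n v j = 0.
Proof.
move=> w0 hJ wJ j Jj.
by rewrite /wmode_term wJ // hJ // w0 hs0 scaler0 addr0 scaler0.
Qed.

(** Both parts go through the induction together: the sum for a word is finite,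
    hence linear, because the modes of its tail are truncated. *)
Lemma wmode_lin_trunc w g : (forall n, linear (@wmode K w g n)) /\
  (forall v, exists N : nat, forall n, N%:Z <= n -> wmode w g n v = 0).
Proof.
elim: w => [|x w [wlin wtr]].
  split=> [n c u v|v].
    by rewrite !wmode_nil; exact: em_lin.
  by have [N eN] := em_trunc g v; exists N => n; rewrite wmode_nil; exact: eN.
have w0 n : wmode w g n 0 = 0 :> V.
  by have := wlin n (-1) 0 0; rewrite !scaleN1r !addNr.
have fin n v : exists J, forall j, (J <= j)%N -> wmode_term x w g n v j = 0.
  have [J hJ] := hs_trunc (toh K (simple_root x.1)) v; have [N wN] := wtr v.
  exists (J + N + `|n|)%N; apply: wmode_term_trunc => // j jJ.
    by apply: hJ; lia.
  by apply: wN; lia.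
split=> [n c u v|v].
  rewrite !wmode_cons -lfsum_lin; try exact: fin.
  congr lfsum; apply/funext => j; rewrite /wmode_term wlin hsD hsZ.
  by rewrite hsD hsZ wlin scaler_lin2.
have [J hJ] := hs_trunc (toh K (simple_root x.1)) v; have [N wN] := wtr v.
have [M wM] : exists M : nat, forall j, (j < J)%N -> forall n, M%:Z <= n ->
    wmode w g n (hs (toh K (simple_root x.1)) (Posz j) v) = 0.
  elim: J {hJ} => [|J [M hM]]; first by exists 0%N.
  have [M' hM'] := wtr (hs (toh K (simple_root x.1)) (Posz J) v).
  exists (maxn M M') => j; rewrite ltnS leq_eqVlt => /orP[/eqP->|jJ] n Mn.
    by apply: hM'; lia.
  by apply: hM => //; lia.
exists (J + N + M + x.2 + 1)%N => n nN; rewrite wmode_cons (lfsumE (N := 0)) ?big_ord0 // => j _.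
rewrite /wmode_term wN; last by lia.
have [jJ|Jj] := ltnP j J; last by rewrite hJ // w0 hs0 scaler0 addr0 scaler0.
by rewrite wM // ?hs0 ?scaler0 ?addr0 ?scaler0 //; lia.
Qed.

Lemma wmode_lin w g n : linear (@wmode K w g n).
Proof. by case: (wmode_lin_trunc w g). Qed.
HB.instance Definition _ w g n :=
  GRing.isLinear.Build K V V *:%R (@wmode K w g n) (@wmode_lin w g n).

Lemma wmode0 w g n : wmode w g n 0 = 0 :> V. Proof. exact: linear0. Qed.
Lemma wmodeD w g n u v : wmode w g n (u + v) = wmode w g n u + wmode w g n v.
Proof. exact: linearD. Qed.
Lemma wmodeZ w g n c v : wmode w g n (c *: v) = c *: wmode w g n v.
Proof. exact: linearZ. Qed.

Lemma wmode_trunc w g v : exists N : nat, forall n, N%:Z <= n -> wmode w g n v = 0.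
Proof. by case: (wmode_lin_trunc w g). Qed.

Lemma wmode_consE x w g n v J :
  (forall j, (J <= j)%N -> hs (toh K (simple_root x.1)) (Posz j) v = 0) ->
  (forall j, (J <= j)%N -> wmode w g (n + j%:Z) v = 0) ->
  wmode (x :: w) g n v = \sum_(j < J) wmode_term x w g n v j.
Proof.
move=> hJ wJ; rewrite wmode_cons; apply: lfsumE; apply: wmode_term_trunc => // k.
exact: wmode0.
Qed.

Lemma wmode_finite x w g n v : exists J,
  (forall j, (J <= j)%N -> hs (toh K (simple_root x.1)) (Posz j) v = 0) /\
  (forall j, (J <= j)%N -> wmode w g (n + j%:Z) v = 0).
Proof.
have [J hJ] := hs_trunc (toh K (simple_root x.1)) v; have [N wN] := wmode_trunc w g v.
by exists (J + N + `|n|)%N; split=> j Jj; [apply: hJ|apply: wN]; lia.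
Qed.

Lemma wmode_fock w g n d v : fock d v -> fock (g + d) (wmode w g n v).
Proof.
elim: w n v => [|x w IHw] n v fv; first by rewrite wmode_nil; exact: em_fock.
have [J [hJ wJ]] := wmode_finite x w g n v.
rewrite (wmode_consE hJ wJ); apply: fock_sum => j _; apply: fockZ; apply: fockD.
  by apply: hs_fock; exact: IHw.
by apply: fockZ; apply: IHw; exact: hs_fock.
Qed.

End WordModes.

(** * Binomial sums *)

Section BinomialSums.
Context (K : numFieldType).
Implicit Types (F : nat -> K).

(** The coefficient extraction that corresponds to a factor (1+t)^A. *)
Definition binsum (A : nat) F : K := \sum_(i < A.+1) 'C(A, i)%:R * F i.

Lemma binsum0 F : binsum 0 F = F 0%N.
Proof. by rewrite /binsum big_ord1 bin0 mul1r. Qed.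

Lemma binsumS A F : binsum A.+1 F = binsum A (fun r => F r + F r.+1).
Proof.
rewrite /binsum; under [RHS]eq_bigr => i _ do rewrite mulrDr.
rewrite big_split /= big_ord_recl bin0 mul1r.
rewrite [X in _ = X + _]big_ord_recl bin0 mul1r -addrA; congr (_ + _).
have -> : \sum_(i < A) 'C(A, lift ord0 i)%:R * F (lift ord0 i) =
          \sum_(i < A.+1) 'C(A, i.+1)%:R * F i.+1.
  by rewrite big_ord_recr /= bin_small // mul0r addr0.
rewrite -big_split; apply: eq_bigr => i _ /=.
by rewrite /bump leq0n add1n binS natrD mulrDl.
Qed.

Lemma eq_binsum A F F' : F =1 F' -> binsum A F = binsum A F'.
Proof. by move=> FF; apply: eq_bigr => i _; rewrite FF. Qed.

Lemma binsum_lin A c F F' :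
  binsum A (fun r => c * F r + F' r) = c * binsum A F + binsum A F'.
Proof.
by rewrite /binsum mulr_sumr -big_split; apply: eq_bigr => i _ /=; rewrite mulrDr mulrCA.
Qed.

Lemma binsum_sum A J (c : nat -> K) (F : nat -> nat -> K) :
  binsum A (fun r => \sum_(j < J) c j * F j r) = \sum_(j < J) c j * binsum A (F j).
Proof.
rewrite /binsum; under eq_bigr => i _ do rewrite mulr_sumr.
rewrite exchange_big; apply: eq_bigr => j _ /=; rewrite mulr_sumr.
by apply: eq_bigr => i _; rewrite mulrCA.
Qed.

(** The inner sum is a factor (1+t)^(-k-1), which cancels k + 1 of the factors 1+t
    of [binsum]. *)
Lemma binsum_shift k A J F : (forall r, (J <= r)%N -> F r = 0) ->
  binsum (A + k.+1) (fun r => \sum_(j < J) (-1) ^+ j * 'C(k + j, k)%:R * F (r + j)%N)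
  = binsum A F.
Proof.
move=> F0; elim: k => [|k IHk].
  rewrite addn1 binsumS; apply: eq_binsum => r.
  case: J F0 => [F0|J F0]; first by rewrite !big_ord0 F0 // addr0.
  rewrite big_ord_recl [X in _ + X]big_ord_recr /= expr0 bin0 addn0 !mul1r.
  rewrite (F0 (r.+1 + J)%N) ?leq_addl // ?addSn; last by rewrite ltnS leq_addl.
  rewrite mulr0 addr0 -addrA -big_split big1 ?addr0 // => j _ /=.
  by rewrite /bump leq0n !bin0 add1n addSnnS exprS; ring.
rewrite addnS binsumS -[RHS]IHk; apply: eq_binsum => r.
case: J F0 {IHk} => [F0|J F0]; first by rewrite !big_ord0 addr0.
rewrite big_ord_recl [X in _ + X]big_ord_recr [RHS]big_ord_recl /= !addn0 !binn.
rewrite (F0 (r.+1 + J)%N) ?addSn; last by rewrite ltnS leq_addl.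
rewrite mulr0 addr0 -addrA -big_split; congr (_ + _); apply: eq_bigr => j _ /=.
rewrite /bump leq0n add1n (addSnnS r) exprS -(addSnnS k) (addnS k.+1) binS natrD.
by ring.
Qed.

(** The coefficient of t^n in (1+t)^a for any integer [n]. *)
Definition gbz (a : K) (n : int) : K := if n is Posz k then gb a k else 0.

Lemma gbzD1 a n : gbz (a + 1) n = gbz a n + gbz a (n - 1).
Proof.
case: n => [[|k]|k].
- by rewrite /= !gb0 addr0.
- have -> : k.+1%:Z - 1 = k%:Z by lia.
  exact: gbD1.
- have -> : Negz k - 1 = Negz k.+1 by lia.
  by rewrite addr0.
Qed.

(** Vandermonde's identity, that is (1+t)^A (1+t)^a = (1+t)^(a+A). *)
Lemma binsum_gbz A a n : binsum A (fun r => gbz a (n - r%:Z)) = gbz (a + A%:R) n.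
Proof.
elim: A a => [|A IHA] a; first by rewrite binsum0 subr0 addr0.
rewrite binsumS -natr1; have -> : a + (A%:R + 1) = (a + 1) + A%:R by ring.
rewrite -IHA; apply: eq_binsum => r; rewrite gbzD1; congr (_ + gbz _ _); lia.
Qed.

End BinomialSums.

(** * Residues of vertex operators *)

Lemma A2form0 g : A2form g 0 = 0.
Proof.
rewrite /A2form -[(0 : A2).1]/(0 : int) -[(0 : A2).2]/(0 : int); ring.
Qed.

Section Residues.
Context (K : numFieldType) (g c : A2) (z : bool -> K).
Implicit Types (v : VA2 K) (w : seq (bool * nat)) (x : bool * nat).
Local Notation V := (VA2 K).

(** The image under [chi c z] of Res_t t^(-e) (1+t)^A Y(a,t)v, for [a] the word
    [w] applied to e^g. *)
Definition rho w (A : nat) (e : int) v : K :=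
  binsum A (fun i => chi c z (wmode w g (i%:Z - e) v)).

Lemma zv_simple i : zv z (toh K (simple_root i)) = z i.
Proof.
rewrite /zv (bigD1 i) //= big1 ?addr0 => [|j /negPf ji].
  by rewrite hcoord_simple eqxx mul1r.
by rewrite hcoord_simple eq_sym ji mul0r.
Qed.

(** The creation half of the first factor is a multiple of (1+t)^(-k-1) and lowers
    [A]; the annihilation half raises the order [e] of the pole and keeps [A]. *)
Lemma rho_cons x w A e v : (x.2 < A)%N -> exists J,
  rho (x :: w) A e v = (-1) ^+ x.2 * z x.1 * rho w (A - x.2.+1) e v
    + \sum_(j < J) ((-1) ^+ x.2 * 'C(x.2 + j, x.2)%:R)
        * rho w A (e + (x.2 + j).+1%:Z) (hs (toh K (simple_root x.1)) j%:Z v).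
Proof.
move=> kA; have [J0 hJ] := hs_trunc (toh K (simple_root x.1)) v.
have [N wN] := wmode_trunc w g v.
pose J := (J0 + N + `|e|)%N; exists J.
pose F r := chi c z (wmode w g (r%:Z - e) v).
pose G j i := chi c z (wmode w g (i%:Z - (e + (x.2 + j).+1%:Z))
                         (hs (toh K (simple_root x.1)) j%:Z v)).
have F0 r : (J <= r)%N -> F r = 0.
  by move=> Jr; rewrite /F wN ?chi0 //; move: Jr; rewrite /J; lia.
rewrite -[rho w (A - x.2.+1) e v]/(binsum (A - x.2.+1) F) -(binsum_shift x.2 _ F0) subnK //.
rewrite -(binsum_sum A J (fun j => (-1) ^+ x.2 * 'C(x.2 + j, x.2)%:R) G) -binsum_lin.
apply: eq_binsum => i; rewrite (@wmode_consE _ x w g _ v J); last 2 first.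
- by move=> j Jj; apply: hJ; move: Jj; rewrite /J; lia.
- by move=> j Jj; apply: wN; move: Jj; rewrite /J; lia.
rewrite chi_sum mulr_sumr -big_split; apply: eq_bigr => j _ /=.
rewrite /wmode_term chiZ chiD chi_neg chiZ zv_simple /F /G exprD.
rewrite PoszD [in X in _ = X]addrAC.
have -> : i%:Z - e - (x.2 + j).+1%:Z = i%:Z - (e + (x.2 + j).+1%:Z) by lia.
by rewrite (mulrC (_ ^+ x.2) 'C(_, _)%:R); ring.
Qed.

(** The creation factor of Y(e^g,t) evaluates to (1+t)^(zv z g), so that each
    annihilation degree [l] contributes one binomial coefficient. *)
Lemma rho_nil d A e v L : fock d v ->
  (forall l, (L <= l)%N -> ann g l (shift g v) = 0) ->
  rho [::] A e v = cocycle K g d *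
    \sum_(l < L) chi c z (ann g l (shift g v)) *
       gbz (zv z (toh K g) + A%:R) (l%:Z - A2form g d + e - 1).
Proof.
move=> fv L0.
transitivity (binsum A (fun i => cocycle K g d * (\sum_(l < L)
    chi c z (ann g l (shift g v)) *
    gbz (zv z (toh K g)) (l%:Z - A2form g d + e - 1 - i%:Z)) + 0)).
  apply: eq_binsum => i; rewrite addr0 wmode_nil (em_fockE _ _ fv) chiZ.
  rewrite (lfsumE (N := L)); last by move=> l Ll; apply: em_term_trunc; exact: L0.
  rewrite chi_sum; congr (_ * _); apply: eq_bigr => l _; rewrite /em_term.
  have -> : l%:Z - A2form g d - (i%:Z - e) - 1 = l%:Z - A2form g d + e - 1 - i%:Z.
    by lia.
  case: (_ - i%:Z) => k /=; last by rewrite chi0 mulr0.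
  by rewrite chi_exp_creation mulrC.
rewrite binsum_lin (binsum_sum A L (fun l => chi c z (ann g l (shift g v)))
  (fun l i => gbz (zv z (toh K g))
  (l%:Z - A2form g d + e - 1 - i%:Z))).
have -> : binsum A (fun=> 0) = 0 :> K by rewrite /binsum big1 // => i _; rewrite mulr0.
rewrite addr0; congr (_ * _); apply: eq_bigr => l _.
by rewrite binsum_gbz.
Qed.

Lemma gbz_vanish (M n : int) : 0 <= M -> M < n -> gbz M%:~R n = 0 :> K.
Proof.
by case: M => M // _; case: n => n // Mn; rewrite /= -pmulrn gb_nat bin_small.
Qed.

(** A factor of [w] either creates and takes its weight out of the exponent of
    1+t, or annihilates and adds its weight to [N]. At the end the binomial
    coefficient has upper entry a + q + N, a natural number, and its lower entry
    is at least N + 1 - (g|d), which is larger. *)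
Lemma rho_vanish d (a : int) (q : nat) : zv z (toh K g) = a%:~R ->
  0 <= a + q%:Z -> a + q%:Z <= - A2form g d ->
  forall w N l v, fock d v -> rho w (word_wt w + q + N) (2 + N + l)%:Z v = 0.
Proof.
move=> za aq0 aqd; elim=> [|x w IHw] N l v fv.
  have [L annL] := ann_trunc g (shift g v).
  rewrite (rho_nil _ _ fv annL) big1 ?mulr0 // => j _.
  have -> : zv z (toh K g) + (word_wt [::] + q + N)%:R = (a + (q + N)%:Z)%:~R.
    by rewrite /word_wt big_nil add0n za [RHS]rmorphD.
  by rewrite gbz_vanish ?mulr0 //; lia.
have [|J ->] := @rho_cons x w (word_wt (x :: w) + q + N) (2 + N + l)%:Z v.
  by rewrite /word_wt big_cons; lia.
have -> : (word_wt (x :: w) + q + N - x.2.+1 = word_wt w + q + N)%N.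
  by rewrite /word_wt big_cons; lia.
rewrite IHw // mulr0 add0r big1 // => j _.
have -> : (word_wt (x :: w) + q + N = word_wt w + q + (N + x.2.+1))%N.
  by rewrite /word_wt big_cons; lia.
have -> : (2 + N + l)%:Z + (x.2 + j).+1%:Z = (2 + (N + x.2.+1) + (l + j))%:Z by lia.
by rewrite IHw ?mulr0 //; exact: hs_fock.
Qed.

(** Against the vacuum only creation operators act. *)
Lemma rho_vacuum w A e : (word_wt w <= A)%N ->
  rho w A e (bv K mset0 0) =
  (\prod_(x <- w) ((-1) ^+ x.2 * z x.1)) * rho [::] (A - word_wt w) e (bv K mset0 0).
Proof.
elim: w A => [|x w IHw] A; first by rewrite /word_wt !big_nil subn0 mul1r.
rewrite {1}/word_wt big_cons => wA.
have [|J ->] := @rho_cons x w A e (bv K mset0 0); first by lia.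
rewrite big1 ?addr0 => [|j _]; last first.
  suff -> : hs (toh K (simple_root x.1)) j%:Z (bv K mset0 0) = 0.
    by rewrite /rho /binsum big1 ?mulr0 // => i _; rewrite wmode0 chi0 mulr0.
  case: (j : nat) => [|k]; last first.
    by rewrite hs_pos big1 // => i _; rewrite mset0E mulr0 scale0r.
  by rewrite hs_zero hform_toh A2form0 scale0r.
rewrite big_cons -[RHS]mulrA; congr (_ * _).
rewrite IHw; last by rewrite /word_wt; lia.
by rewrite /word_wt big_cons subnDA.
Qed.

End Residues.

(** * The Virasoro grading *)

Section SmallModes.
Context (K : numFieldType).
Implicit Types (u v : VA2 K) (h : cartan K) (m : modes) (g d : A2).
Implicit Types (n : int).
Local Notation V := (VA2 K).

Lemma exp_coef_killed (x : nat -> V -> V) k v : (forall j, x j 0 = 0) ->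
  (forall j, x j.+1 v = 0) -> exp_coef x k v = if k == 0%N then v else 0.
Proof.
move=> x0 xv.
have p1 k' : pow_coef x 1 k' v = 0.
  rewrite /= big_add1 big_mkord big1 // => j _.
  by case: eqP; rewrite ?xv ?x0 scaler0.
have p2 r k' : pow_coef x r.+1 k' v = 0.
  elim: r k' => [|r IHr] k'; first exact: p1.
  rewrite [LHS]/= big1 // => j _.
  by rewrite -[X in x j X]/(pow_coef x r.+1 _ _) IHr x0 scaler0.
rewrite /exp_coef big_ord_recl /= invr1 scale1r big1 ?addr0 // => r _.
by rewrite -[X in _ *: X]/(pow_coef x r.+1 _ _) p2 scaler0.
Qed.

Lemma A2form0l g : A2form 0 g = 0.
Proof.
rewrite /A2form -[(0 : A2).1]/(0 : int) -[(0 : A2).2]/(0 : int); ring.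
Qed.

Lemma hs_toh0 n v : hs (toh K 0) n v = 0.
Proof.
move: v; apply: VA2_ind => [|u v eu ev|c v ev|m g].
- exact: hs0.
- by rewrite hsD eu ev addr0.
- by rewrite hsZ ev scaler0.
case: n => [[|k]|k].
- by rewrite hs_zero hform_toh A2form0l scale0r.
- by rewrite hs_pos big1 // => i _; rewrite hform_toh A2form0l mulr0 mul0r scale0r.
- by rewrite hs_neg big1 // => -[] _; rewrite /hcoord /= scale0r.
Qed.

Lemma em_zero n v : em 0 n v = if n == -1 then v else 0.
Proof.
move: v; apply: VA2_ind => [|u v eu ev|c v ev|m d].
- by rewrite linear0 if_same.
- by rewrite linearD /= eu ev; case: eqP => // _; rewrite addr0.
- by rewrite linearZ /= ev; case: eqP => // _; rewrite scaler0.
have annE l : ann 0 l (bv K m d) = if l == 0%N then bv K m d else 0.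
  by apply: exp_coef_killed => j; rewrite hs_toh0 oppr0.
rewrite em_bv (lfsumE (N := 1)); last first.
  move=> l l1; apply: em_term_trunc; rewrite shift_bv add0r annE.
  by case: eqP l1 => // ->.
rewrite big_ord1 /em_term shift_bv (add0r d) annE A2form0l /=.
rewrite /cocycle -[(0 : A2).2]/(0 : int) mul0r expr0z scale1r subr0 sub0r.
have -> : - n - 1 = -(n + 1) by lia.
case: n => [n|[|n]].
- by have -> : - (n%:Z + 1) = Negz n by lia.
- by have -> : - (Negz 0 + 1) = 0%N%:Z by []; rewrite exp_coef0.
- have -> : - (Negz n.+1 + 1) = n.+1%:Z by lia.
  by rewrite exp_coef_killed => // j; rewrite hs_toh0.
Qed.

Lemma wmode1_neg i k p v : wmode [:: (i, k)] 0 (Negz p) v =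
  'C(k + p, k)%:R *: hs (toh K (simple_root i)) (Negz (k + p)) v.
Proof.
have [J hJ] := hs_trunc (toh K (simple_root i)) v.
rewrite (@wmode_consE _ _ _ _ _ _ (J + p.+1)%N); last 2 first.
- by move=> j Jj; apply: hJ; lia.
- move=> j Jj; rewrite wmode_nil em_zero; case: eqP => //; lia.
have pJ : (p < J + p.+1)%N by lia.
rewrite (bigD1 (Ordinal pJ)) //= big1 => [|j jp]; rewrite /wmode_term /= !wmode_nil !em_zero.
  by do ![case: eqP => ?; try (exfalso; lia)]; rewrite ?scaler0 ?addr0.
have jp' : nat_of_ord j <> p by move=> E; case/eqP: jp; exact: val_inj.
by do ![case: eqP => ?; try (exfalso; lia)]; rewrite ?hs0 ?scaler0 ?addr0 ?scaler0.
Qed.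

Lemma wmode1_pos i p v : wmode [:: (i, 0%N)] 0 (Posz p) v =
  hs (toh K (simple_root i)) (Posz p) v.
Proof.
have [J hJ] := hs_trunc (toh K (simple_root i)) v.
rewrite (@wmode_consE _ _ _ _ _ _ (J + p.+1)%N); last 2 first.
- by move=> j Jj; apply: hJ; lia.
- move=> j Jj; rewrite wmode_nil em_zero; case: eqP => //; lia.
have pJ : (p < J + p.+1)%N by lia.
rewrite (bigD1 (Ordinal pJ)) //= big1 => [|j jp]; rewrite /wmode_term /= !wmode_nil !em_zero.
  do ![case: eqP => ?; try (exfalso; lia)].
  by rewrite bin0 hs0 add0r expr0 !scale1r addr0.
have jp' : nat_of_ord j <> p by move=> E; case/eqP: jp; exact: val_inj.
by do ![case: eqP => ?; try (exfalso; lia)]; rewrite ?hs0 ?scaler0 ?addr0 ?scaler0.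
Qed.

Lemma wmode1_small i k p v : (p < k)%N -> wmode [:: (i, k)] 0 (Posz p) v = 0.
Proof.
move=> pk; have [J hJ] := hs_trunc (toh K (simple_root i)) v.
rewrite (@wmode_consE _ _ _ _ _ _ J); last 2 first.
- by move=> j Jj; apply: hJ; lia.
- move=> j Jj; rewrite wmode_nil em_zero; case: eqP => //; lia.
rewrite big1 // => j _; rewrite /wmode_term /= !wmode_nil !em_zero.
by do ![case: eqP => ?; try (exfalso; lia)]; rewrite ?hs0 ?scaler0 ?addr0 ?scaler0.
Qed.

(** The contribution of a quadratic monomial to L(0), as in the Sugawara
    construction. *)
Lemma wmode2 i j v : exists N : nat, forall J, (N <= J)%N ->
  wmode [:: (i, 0%N); (j, 0%N)] 0 1 v =
  hs (toh K (simple_root j)) (Posz 0) (hs (toh K (simple_root i)) (Posz 0) v) +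
  \sum_(l < J) (hs (toh K (simple_root i)) (Negz l) (hs (toh K (simple_root j)) l.+1 v)
    + hs (toh K (simple_root j)) (Negz l) (hs (toh K (simple_root i)) l.+1 v)).
Proof.
have [N1 h1] := hs_trunc (toh K (simple_root i)) v.
have [N2 h2] := hs_trunc (toh K (simple_root j)) v.
exists (N1 + N2 + 1)%N => J NJ; rewrite (@wmode_consE _ _ _ _ _ _ J.+1); last 2 first.
- by move=> l Jl; apply: h1; lia.
- move=> l Jl; rewrite (_ : 1 + l%:Z = l.+1%:Z); last by lia.
  by rewrite wmode1_pos h2 //; lia.
have E1 l : wmode_term (i, 0%N) [:: (j, 0%N)] 0 1 v l =
   hs (toh K (simple_root i)) (Negz l) (hs (toh K (simple_root j)) l.+1 v)
   + wmode [:: (j, 0%N)] 0 (- l%:Z) (hs (toh K (simple_root i)) l%:Z v).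
  rewrite /wmode_term /= bin0 !add0n expr0 !scale1r (_ : 1 + l%:Z = l.+1%:Z); last by lia.
  by rewrite wmode1_pos (_ : 1 - l.+1%:Z = - l%:Z) //; lia.
under eq_bigr => l _ do rewrite E1.
rewrite !big_split /= [X in X + _ = _]big_ord_recr /= (h2 J.+1); last by lia.
rewrite hs0 addr0 [X in _ + X = _]big_ord_recl /= oppr0 wmode1_pos.
rewrite addrCA; congr (_ + (_ + _)); apply: eq_bigr => l _.
by rewrite -NegzE wmode1_neg bin0 scale1r.
Qed.

End SmallModes.

Section Grading.
Context (K : numFieldType).
Implicit Types (u v a b : VA2 K) (h : cartan K) (m : modes) (g d : A2).
Implicit Types (n : int).
Local Notation V := (VA2 K).
Local Notation sr i := (toh K (simple_root i)).

(** (g|g)/2, the conformal weight of e^g. *)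
Definition half_norm g : nat := absz (g.1 * g.1 - g.1 * g.2 + g.2 * g.2).

Lemma half_normE g : A2form g g = (half_norm g).*2%:Z.
Proof.
rewrite /half_norm /A2form; case: g => x y /=.
have : 0 <= x * x - x * y + y * y by nia.
lia.
Qed.

Definition bwt (x : latbasis) : nat := (mode_wt x.1 + half_norm x.2)%N.

Lemma YmodeE a n b : Ymode a n b = lext (fun x => wmode (enum_mset x.1) x.2 n b) a.
Proof. by rewrite wmode.unlock. Qed.

Lemma Ymode_bv m g n b : Ymode (bv K m g) n b = wmode (enum_mset m) g n b.
Proof. by rewrite YmodeE lextU. Qed.

Lemma Ymode0l n b : Ymode 0 n b = 0. Proof. by rewrite YmodeE linear0. Qed.
Lemma YmodeDl a a' n b : Ymode (a + a') n b = Ymode a n b + Ymode a' n b.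
Proof. by rewrite !YmodeE linearD. Qed.
Lemma YmodeZl c a n b : Ymode (c *: a) n b = c *: Ymode a n b.
Proof. by rewrite !YmodeE linearZ. Qed.

Lemma Ymode0r a n : Ymode a n 0 = 0.
Proof. by rewrite YmodeE /lext big1 // => x _; rewrite wmode0 scaler0. Qed.
Lemma YmodeDr a n b b' : Ymode a n (b + b') = Ymode a n b + Ymode a n b'.
Proof.
rewrite !YmodeE /lext -big_split; apply: eq_bigr => x _.
by rewrite wmodeD scalerDr.
Qed.
Lemma YmodeZr a n c b : Ymode a n (c *: b) = c *: Ymode a n b.
Proof.
rewrite !YmodeE /lext scaler_sumr; apply: eq_bigr => x _.
by rewrite wmodeZ !scalerA mulrC.
Qed.

(** Three times L(0) without its zero modes: the inverse of the Cartan matrix of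
    A_2 is one third of the matrix with rows (2,1) and (1,2). *)
Definition casimir (J : nat) v : V :=
  \sum_(l < J) (2 *: hs (sr false) (Negz l) (hs (sr false) l.+1 v)
    + hs (sr false) (Negz l) (hs (sr true) l.+1 v)
    + hs (sr true) (Negz l) (hs (sr false) l.+1 v)
    + 2 *: hs (sr true) (Negz l) (hs (sr true) l.+1 v)).

Lemma hform_simple i j : hform (sr i) (sr j) = if i == j then 2 else -1.
Proof. by rewrite hform_toh A2form_simple; case: eqP. Qed.

(** A creation operator of weight k + 1 raises the eigenvalue by 3 (k + 1), since
    (2(alpha|x) + (beta|x)) alpha + ((alpha|x) + 2(beta|x)) beta = 3x. *)
Lemma casimir_term i k l v :
  (2 : K) *: hs (sr false) (Negz l) (hs (sr false) l.+1 (hs (sr i) (Negz k) v))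
    + hs (sr false) (Negz l) (hs (sr true) l.+1 (hs (sr i) (Negz k) v))
    + hs (sr true) (Negz l) (hs (sr false) l.+1 (hs (sr i) (Negz k) v))
    + 2 *: hs (sr true) (Negz l) (hs (sr true) l.+1 (hs (sr i) (Negz k) v)) =
  hs (sr i) (Negz k) (2 *: hs (sr false) (Negz l) (hs (sr false) l.+1 v)
    + hs (sr false) (Negz l) (hs (sr true) l.+1 v)
    + hs (sr true) (Negz l) (hs (sr false) l.+1 v)
    + 2 *: hs (sr true) (Negz l) (hs (sr true) l.+1 v))
  + (if l == k then 3 * k.+1%:R else 0) *: hs (sr i) (Negz k) v.
Proof.
have comb (W : lmodType K) (x y z t f s : W) (c p q : K) :
    2 *: (x + (c * p) *: f) + (y + (c * q) *: f) + (z + (c * p) *: s)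
      + 2 *: (t + (c * q) *: s)
    = 2 *: x + y + z + 2 *: t + ((c * (2 * p + q)) *: f + (c * (p + 2 * q)) *: s).
  have -> : c * (2 * p + q) = 2 * (c * p) + c * q by ring.
  have -> : c * (p + 2 * q) = c * p + 2 * (c * q) by ring.
  have gen (a1 a2 a3 a4 b1 b2 b3 b4 : W) :
      (a1 + b1) + (a2 + b2) + (a3 + b3) + (a4 + b4)
      = a1 + a2 + a3 + a4 + (b1 + b2 + (b3 + b4)).
    by rewrite (addrACA a1 b1) (addrACA (a1 + a2)) (addrACA (a1 + a2 + a3)) (addrA (b1 + b2)).
  by rewrite !scalerDr gen (scalerDl f (2 * (c * p))) (scalerDl s (c * p)) !scalerA.
have E x y : hs (sr x) (Negz l) (hs (sr y) l.+1 (hs (sr i) (Negz k) v)) =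
   hs (sr i) (Negz k) (hs (sr x) (Negz l) (hs (sr y) l.+1 v))
   + ((l == k)%:R * l.+1%:R * hform (sr y) (sr i)) *: hs (sr x) (Negz l) v.
  by rewrite hs_comm hsD hsZ hs_negC.
rewrite !E comb !hsD !hsZ; congr (_ + _).
case: eqP => [->|_]; last by rewrite !mul0r !scale0r addr0.
rewrite !hform_simple mul1r; case: i {E} => /=.
  by rewrite (_ : 2 * -1 + 2 = 0) ?mulr0 ?scale0r ?add0r; [congr (_ *: _); ring|ring].
by rewrite (_ : 2 + 2 * -1 = 0) ?mulr0 ?scale0r ?addr0; [congr (_ *: _); ring|ring].
Qed.

Lemma casimir_bv J m g : (mode_wt m <= J)%N ->
  casimir J (bv K m g) = (3 * (mode_wt m)%:R) *: bv K m g.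
Proof.
move: m; apply: modes_ind => [_|x m IHm].
  rewrite /mode_wt /word_wt enum_mset0 big_nil mulr0 scale0r /casimir big1 // => l _.
  have kill i : hs (sr i) l.+1 (bv K mset0 g) = 0.
    by rewrite hs_pos big1 // => j _; rewrite mset0E mulr0 scale0r.
  by rewrite !kill !hs0 !scaler0 !addr0.
rewrite mode_wt_cons => mJ; case: x mJ => i k /= mJ.
rewrite -hs_simple /casimir; under eq_bigr => l _ do rewrite casimir_term.
rewrite big_split /= -hs_sum -/(casimir J _) IHm; last by lia.
have kJ : (k < J)%N by lia.
rewrite (bigD1 (Ordinal kJ)) //= eqxx big1 ?addr0 => [|l lk]; last first.
  by rewrite ifF ?scale0r //; apply/negP => /eqP E; case/eqP: lk; exact: val_inj.
rewrite hsZ -scalerDl; congr (_ *: _); rewrite natrD; ring.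
Qed.

Lemma omegaE : omega K = 3^-1 *: (bv K ((false, 0%N) +` ((false, 0%N) +` mset0))%mset 0
   + bv K ((false, 0%N) +` ((true, 0%N) +` mset0))%mset 0
   + bv K ((true, 0%N) +` ((true, 0%N) +` mset0))%mset 0).
Proof.
have -> : omega K = 2^-1 *: (hs (sr false) (Negz 0) (hs (2 / 3, 1 / 3) (Negz 0) (bv K mset0 0))
           + hs (sr true) (Negz 0) (hs (1 / 3, 2 / 3) (Negz 0) (bv K mset0 0))).
  by rewrite hs.unlock bv.unlock.
rewrite !hs_neg !hs_sum !big_bool !hsZ !hs_simple /hcoord /=.
rewrite (msetDCA [mset (true, 0%N)]%mset [mset (false, 0%N)]%mset).
have comb (W : lmodType K) (x y z : W) : 2^-1 *: ((1 / 3) *: y + (2 / 3) *: x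
    + ((2 / 3) *: z + (1 / 3) *: y)) = 3^-1 *: (x + y + z).
  rewrite [_ *: z + _]addrC addrACA -scalerDl addrCA !scalerDr !scalerA addrA.
  by congr (_ *: _ + _ *: _ + _ *: _); field.
exact: comb.
Qed.

Lemma perm_eq2 (T : eqType) (s : seq T) (x y : T) : perm_eq s [:: x; y] ->
  s = [:: x; y] \/ s = [:: y; x].
Proof.
move=> sxy; have := perm_size sxy; case: s sxy => [|a [|b []]] //= sxy _.
have := perm_mem sxy a; rewrite !inE eqxx /= => /esym/orP[/eqP ax|/eqP ay].
  left; subst a; move: sxy; rewrite perm_cons => /perm_mem/(_ b).
  by rewrite !inE eqxx => /esym/eqP ->.
right; subst a; have : perm_eq [:: y; b] [:: y; x].
  by apply: (perm_trans sxy); rewrite (perm_catC [:: x] [:: y]).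
by rewrite perm_cons => /perm_mem/(_ b); rewrite !inE eqxx => /esym/eqP ->.
Qed.

Lemma enum_mset2 (x y : bool * nat) :
  enum_mset (x +` (y +` mset0))%mset = [:: x; y] \/
  enum_mset (x +` (y +` mset0))%mset = [:: y; x].
Proof.
apply: perm_eq2; apply: (perm_trans (enum_mset_cons _ _)); rewrite perm_cons.
by apply: (perm_trans (enum_mset_cons _ _)); rewrite enum_mset0.
Qed.

(** Whichever way the two factors of the monomial are listed, the result is the
    same symmetric expression. *)
Lemma quadratic_mode i j m g : exists N : nat, forall J, (N <= J)%N ->
  Ymode (bv K ((i, 0%N) +` ((j, 0%N) +` mset0))%mset 0) 1 (bv K m g) =
  (hform (sr i) (toh K g) * hform (sr j) (toh K g)) *: bv K m g +
  \sum_(l < J) (hs (sr i) (Negz l) (hs (sr j) l.+1 (bv K m g))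
    + hs (sr j) (Negz l) (hs (sr i) l.+1 (bv K m g))).
Proof.
rewrite Ymode_bv; case: (enum_mset2 (i, 0%N) (j, 0%N)) => ->.
  have [N E] := wmode2 i j (bv K m g); exists N => J NJ.
  by rewrite (E J NJ) hs_zero hsZ hs_zero scalerA.
have [N E] := wmode2 j i (bv K m g); exists N => J NJ.
rewrite (E J NJ) hs_zero hsZ hs_zero scalerA mulrC; congr (_ + _).
by apply: eq_bigr => l _; exact: addrC.
Qed.

Lemma half_norm_simple g : A2form (simple_root false) g * A2form (simple_root false) g
  + A2form (simple_root false) g * A2form (simple_root true) g
  + A2form (simple_root true) g * A2form (simple_root true) g = 3 * (half_norm g)%:Z.
Proof.
have := half_normE g; rewrite -mul2n PoszM /A2form; case: g => x y /=.
by move: (half_norm _)%:Z => q; nia.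
Qed.

Lemma L0_bv m g : Ymode (omega K) 1 (bv K m g) = (bwt (m, g))%:R *: bv K m g.
Proof.
have [N1 E1] := quadratic_mode false false m g.
have [N2 E2] := quadratic_mode false true m g.
have [N3 E3] := quadratic_mode true true m g.
pose J := (N1 + N2 + N3 + mode_wt m)%N.
rewrite omegaE YmodeZl !YmodeDl (E1 J) ?(E2 J) ?(E3 J) /J; try lia.
rewrite -/J !hform_toh.
have gen (W : lmodType K) (a b c : K) (v : W) (f f' f1 f2 : 'I_J -> W) :
    a *: v + \sum_l (f l + f l) + (b *: v + \sum_l (f1 l + f2 l))
    + (c *: v + \sum_l (f' l + f' l))
    = (a + b + c) *: v + \sum_l (2 *: f l + f1 l + f2 l + 2 *: f' l).
  rewrite (addrACA (a *: v)) (addrACA (a *: v + b *: v)) -!scalerDl -!big_split.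
  have dbl w : (2 : K) *: w = w + w :> W by rewrite scaler_nat mulr2n.
  by congr (_ + _); apply: eq_bigr => l _ /=; rewrite !dbl !addrA.
rewrite gen -/(casimir J _) casimir_bv; last by rewrite /J; lia.
rewrite -scalerDl scalerA; congr (_ *: _).
rewrite -!rmorphM -!rmorphD half_norm_simple rmorphM /= /bwt /= natrD.
have -> : (Posz (half_norm g))%:~R = (half_norm g)%:R :> K by [].
by field.
Qed.

Lemma L0_coef v x : (Ymode (omega K) 1 v)@_x = (bwt x)%:R * v@_x.
Proof.
move: v; apply: VA2_ind => [|u v eu ev|c v ev|m g].
- by rewrite Ymode0r mcoeff0 mulr0.
- by rewrite YmodeDr !mcoeffD eu ev mulrDr.
- by rewrite YmodeZr !mcoeffZ ev mulrCA.
by rewrite L0_bv mcoeffZ mcoeff_bv; case: eqP => [->//|_]; rewrite !mulr0.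
Qed.

Lemma homogeneous_bv m g : homogeneous (@Ymode K) (omega K) (bwt (m, g)) (bv K m g).
Proof. exact: L0_bv. Qed.

(** L(0) is diagonal on the basis. *)
Lemma homogeneous_supp k v : homogeneous (@Ymode K) (omega K) k v ->
  forall x, x \in msupp v -> bwt x = k.
Proof.
move=> hv x; rewrite -mcoeff_neq0 => vx.
have := congr1 (fun w : V => w@_x) hv; rewrite /= L0_coef mcoeffZ => /(mulIf vx)/eqP.
by rewrite eqr_nat => /eqP.
Qed.

End Grading.

(** * The circle product at the zeros of the relations *)

Section Circle.
Context (K : numFieldType).
Implicit Types (u v a b : VA2 K) (m : modes) (g d c : A2) (z : bool -> K).
Local Notation V := (VA2 K).
Local Notation circ := (zhu_circ (@Ymode K)).

Lemma circ0l k b : circ k 0 b = 0.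
Proof. by rewrite /zhu_circ big1 // => i _; rewrite Ymode0l scaler0. Qed.
Lemma circDl k a a' b : circ k (a + a') b = circ k a b + circ k a' b.
Proof. by rewrite /zhu_circ -big_split; apply: eq_bigr => i _; rewrite YmodeDl scalerDr. Qed.
Lemma circZl k x a b : circ k (x *: a) b = x *: circ k a b.
Proof.
rewrite /zhu_circ scaler_sumr; apply: eq_bigr => i _.
by rewrite YmodeZl !scalerA mulrC.
Qed.
Lemma circ0r k a : circ k a 0 = 0.
Proof. by rewrite /zhu_circ big1 // => i _; rewrite Ymode0r scaler0. Qed.
Lemma circDr k a b b' : circ k a (b + b') = circ k a b + circ k a b'.
Proof. by rewrite /zhu_circ -big_split; apply: eq_bigr => i _; rewrite YmodeDr scalerDr. Qed.
Lemma circZr k x a b : circ k a (x *: b) = x *: circ k a b.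
Proof.
rewrite /zhu_circ scaler_sumr; apply: eq_bigr => i _.
by rewrite YmodeZr !scalerA mulrC.
Qed.

Lemma circ_fock k m g d b : fock d b -> fock (g + d) (circ k (bv K m g) b).
Proof.
move=> fb; apply: fock_sum => i _; apply: fockZ; rewrite Ymode_bv.
exact: wmode_fock.
Qed.

Lemma chi_circ c z k m g b :
  chi c z (circ k (bv K m g) b) = rho g c z (enum_mset m) k 2%:Z b.
Proof.
rewrite /zhu_circ chi_sum /rho /binsum; apply: eq_bigr => i _.
by rewrite chiZ Ymode_bv.
Qed.

(** The common zeros of the polynomials of the relations on M(1,c). There are none
    when the relations contain all of M(1,c), and for [c = 0] the value of beta is
    free. *)
Definition zeros c z : Prop :=
  [\/ c = 0 /\ [\/ z false = 0, z false = 1 | z false = -1],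
      c = alpha /\ z false = -1,
      c = - alpha /\ z false = 1 |
      (c = beta /\ z true = -1 /\ (z false = 0 \/ z false = 1)) \/
      (c = alpha + beta /\
        ((z false = 0 /\ z true = -1) \/ (z false = -1 /\ z true = 0)))].

Lemma zv_toh z g : zv z (toh K g) = g.1%:~R * z false + g.2%:~R * z true.
Proof. by rewrite /zv big_bool /= /hcoord /= addrC. Qed.

(** Only few splittings g + d of each [c] arise, as the coefficients of beta are
    nonnegative; in each of them the bounds are quadratic inequalities in the
    coefficient of alpha that hold over the integers, though not over the reals. *)
Lemma zeros_bound g d z : inP g -> inP d -> zeros (g + d) z ->
  exists a : int, [/\ zv z (toh K g) = a%:~R, 0 <= a + (half_norm g)%:Z
    & a + (half_norm g)%:Z <= - A2form g d].
Proof.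
rewrite zv_toh /inP; have := half_normE g; rewrite -mul2n PoszM /A2form.
case: g d => x y [x' y'] /=; move: (half_norm _)%:Z => q qE y0 y'0.
have split (p r : int) : (x, y) + (x', y') = (p, r) :> A2 -> x + x' = p /\ y + y' = r by case.
case=> [] [].
- move=> /(split 0 0)[xE yE] zE; have y_0 : y = 0 by lia.
  have y'_0 : y' = 0 by lia. have x'E : x' = - x by lia. subst.
  by case: zE => ->; [exists 0|exists x|exists (-x)]; split;
    rewrite ?rmorphN ?rmorph0; try ring; nia.
- move=> /(split 1 0)[xE yE] ->; have y_0 : y = 0 by lia.
  have y'_0 : y' = 0 by lia. have x'E : x' = 1 - x by lia. subst.
  by exists (-x); split; rewrite ?rmorphN ?rmorph0; try ring; nia.
- move=> /(split (-1) 0)[xE yE] ->; have y_0 : y = 0 by lia.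
  have y'_0 : y' = 0 by lia. have x'E : x' = -1 - x by lia. subst.
  by exists x; split; rewrite ?rmorphN ?rmorph0; try ring; nia.
- move=> [/(split 0 1)[xE yE] [-> zE]]; have x'E : x' = - x by lia.
  have [yy|yy] : y = 0 \/ y = 1 by lia.
    have y'E : y' = 1 by lia. subst.
    by case: zE => ->; [exists 0|exists x]; split; rewrite ?rmorphN ?rmorph0; try ring; nia.
  have y'E : y' = 0 by lia. subst.
  by case: zE => ->; [exists (-1)|exists (x-1)]; split;
    rewrite ?rmorphB ?rmorphN ?rmorph0 ?rmorph1; try ring; nia.
- move=> [/(split 1 1)[xE yE] zE]; have x'E : x' = 1 - x by lia.
  have [yy|yy] : y = 0 \/ y = 1 by lia.
    have y'E : y' = 1 by lia. subst.
    by case: zE => -[-> ->]; [exists 0|exists (-x)]; split;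
      rewrite ?rmorphN ?rmorph0; try ring; nia.
  have y'E : y' = 0 by lia. subst.
  by case: zE => -[-> ->]; [exists (-1)|exists (-x)]; split;
    rewrite ?rmorphB ?rmorphN ?rmorph0 ?rmorph1; try ring; nia.
Qed.

Lemma circ_vanish c z m g d b : inP g -> inP d -> fock d b -> zeros c z ->
  chi c z (circ (bwt (m, g)) (bv K m g) b) = 0.
Proof.
move=> gP dP fb cz; have [cE|cE] := eqVneq (g + d) c; last first.
  exact: (@chi_fock K c (g + d) z _ (@circ_fock _ m g d b fb) cE).
subst c; have [a [za a0 ad]] := zeros_bound gP dP cz.
have := @rho_vanish _ g (g + d) z d a (half_norm g) za a0 ad (enum_mset m) 0 0 b fb.
by rewrite chi_circ !addn0.
Qed.

End Circle.

(** * Fock spaces modulo translation *)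

Section Components.
Context (K : numFieldType).
Implicit Types (u v : VA2 K) (m : modes) (g c : A2) (z : bool -> K).
Local Notation V := (VA2 K).

Definition fock_proj c : V -> V := lext (fun b => if b.2 == c then bv K b.1 b.2 else 0).

Lemma fock_proj_bv c m g : fock_proj c (bv K m g) = if g == c then bv K m g else 0.
Proof. exact: lextU. Qed.
Lemma fock_proj0 c : fock_proj c 0 = 0. Proof. exact: linear0. Qed.
Lemma fock_projD c u v : fock_proj c (u + v) = fock_proj c u + fock_proj c v.
Proof. exact: linearD. Qed.
Lemma fock_projZ c x v : fock_proj c (x *: v) = x *: fock_proj c v. Proof. exact: linearZ. Qed.

Lemma fock_proj_fock c v : fock c (fock_proj c v).
Proof.
move: v; apply: VA2_ind => [|u v eu ev|x v ev|m g].
- by rewrite fock_proj0; exact: fock0.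
- by rewrite fock_projD; exact: fockD.
- by rewrite fock_projZ; exact: fockZ.
rewrite fock_proj_bv; case: eqP => [->|_]; first exact: fock_bv.
exact: fock0.
Qed.

Lemma chi_fock_proj c z v : chi c z (fock_proj c v) = chi c z v.
Proof.
move: v; apply: VA2_ind => [|u v eu ev|x v ev|m g].
- by rewrite fock_proj0.
- by rewrite fock_projD !chiD eu ev.
- by rewrite fock_projZ !chiZ ev.
by rewrite fock_proj_bv chi_bv; case: eqP => [->|_]; rewrite ?chi0 // chi_bv eqxx.
Qed.

Lemma fock_proj_VP c v : VP K v -> ~ inP c -> fock_proj c v = 0.
Proof.
move=> Pv cP; move: v Pv; apply: VP_ind => [|u v eu ev|x v ev|m g gP].
- exact: fock_proj0.
- by rewrite fock_projD eu ev addr0.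
- by rewrite fock_projZ ev scaler0.
by rewrite fock_proj_bv; case: eqP => // gc; subst.
Qed.

Lemma fock_proj_sum v : exists s : seq A2, forall s', uniq s' -> {subset s <= s'} ->
  v = \sum_(c <- s') fock_proj c v.
Proof.
move: v; apply: VA2_ind => [|u v [s1 e1] [s2 e2]|x v [s e]|m g].
- by exists [::] => s' _ _; rewrite big1 // => c _; rewrite fock_proj0.
- exists (s1 ++ s2) => s' us ss; under eq_bigr => c _ do rewrite fock_projD.
  rewrite big_split -e1 // -?e2 // => c cs; apply: ss; rewrite mem_cat cs ?orbT //.
- exists s => s' us ss; under eq_bigr => c _ do rewrite fock_projZ.
  by rewrite -scaler_sumr -e.
exists [:: g] => s' us ss; rewrite (bigD1_seq g) //=; last by apply: ss; rewrite inE.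
rewrite fock_proj_bv eqxx big1 ?addr0 // => c cg.
by rewrite fock_proj_bv eq_sym (negPf cg).
Qed.

Lemma by_parts (Q : V -> Prop) v : Q 0 -> (forall u u', Q u -> Q u' -> Q (u + u')) ->
  (forall c, inP c -> Q (fock_proj c v)) -> VP K v -> Q v.
Proof.
move=> Q0 QD Qp Pv; have [s /(_ (undup s))] := fock_proj_sum v; rewrite undup_uniq.
move=> E; rewrite E //; last by move=> c; rewrite mem_undup.
apply: (big_ind Q) => // c _.
have [cP|cP] := pselect (inP c); first exact: Qp.
by rewrite fock_proj_VP.
Qed.

End Components.

Lemma poly_infinite_zeros (R : idomainType) (f : nat -> R) (p : {poly R}) :
  injective f -> (forall n, p.[f n] = 0) -> p = 0.
Proof.
move=> fI pf; apply: (@roots_geq_poly_eq0 _ _ [seq f n | n <- iota 0 (size p)]).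
- by apply/allP => x /mapP[n _ ->]; rewrite /root pf.
- by rewrite map_inj_uniq ?iota_uniq.
- by rewrite size_map size_iota.
Qed.

Section PolynomialAction.
Context (R : comNzRingType) (K : numFieldType) (V : lmodType K).
Variables (X : {linear V -> V}) (act : R -> V).
Hypothesis actD : forall a b, act (a + b) = act a + act b.
Implicit Types (p : {poly R}).

(** The polynomial [p] in the operator [X], its coefficients acting by [act]. It is
    used twice, to build polynomials in two commuting operators. *)
Definition papply p : V := \sum_(i < size p) iter i X (act p`_i).

Lemma act0 : act 0 = 0.
Proof. by apply: (addIr (act 0)); rewrite -actD addr0 add0r. Qed.

Lemma iterX0 i : iter i X 0 = 0.
Proof. by elim: i => //= i ->; rewrite linear0. Qed.

Lemma iterXD i u v : iter i X (u + v) = iter i X u + iter i X v.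
Proof. by elim: i => //= i ->; rewrite linearD. Qed.

Lemma papply_widen n p : (size p <= n)%N -> papply p = \sum_(i < n) iter i X (act p`_i).
Proof.
move=> pn; rewrite /papply (big_ord_widen n (fun i => iter i X (act p`_i))) // big_mkcond.
apply: eq_bigr => i _; case: ltnP => // pi.
by rewrite nth_default // act0 iterX0.
Qed.

Lemma papplyD p q : papply (p + q) = papply p + papply q.
Proof.
pose n := maxn (size (p + q)) (maxn (size p) (size q)).
rewrite !(@papply_widen n) ?leq_max ?leqnn ?orbT // -big_split; apply: eq_bigr => i _.
by rewrite coefD actD iterXD.
Qed.

Lemma papplyC a : papply a%:P = act a.
Proof.
by rewrite (@papply_widen 1) ?size_polyC_leq1 // big_ord1 coefC.
Qed.

Lemma papplyMX p : papply ('X * p) = X (papply p).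
Proof.
rewrite mulrC (@papply_widen (size p).+1) ?size_mulX_leq //; last first.
  have [->|p0] := eqVneq p 0; first by rewrite mul0r size_poly0.
  by rewrite size_mulX.
rewrite big_ord_recl coefMX /= act0 add0r /papply linear_sum; apply: eq_bigr => i _ /=.
by rewrite coefMX.
Qed.

(** Used for multiplication by scalars and for the operator of the inner
    variable. *)
Lemma papply_coef (T : {linear V -> V}) r : (forall a, act (r * a) = T (act a)) ->
  (forall v, X (T v) = T (X v)) -> forall p, papply (r%:P * p) = T (papply p).
Proof.
move=> aT XT p; have iT i v : iter i X (T v) = T (iter i X v).
  by elim: i => //= i ->; rewrite XT.
rewrite (@papply_widen (size p)); last by rewrite mul_polyC size_scale_leq.
rewrite /papply linear_sum; apply: eq_bigr => i _.
by rewrite coefCM aT iT.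
Qed.

End PolynomialAction.

Section ModuloTranslation.
Context (K : numFieldType).
Implicit Types (u v : VA2 K) (h : cartan K) (m : modes) (g c : A2) (z : bool -> K).
Local Notation V := (VA2 K).
Local Notation sr i := (toh K (simple_root i)).

Definition transl_rels : set V := [set x | exists (h : cartan K) (n : nat) (u : V),
  VP K u /\ x = heis h (- n%:Z - 2) u + heis h (- n%:Z - 1) u].

Lemma transl_relsE x : transl_rels x <-> exists (h : cartan K) (n : nat) (u : V),
  VP K u /\ x = hs h (Negz n.+1) u + hs h (Negz n) u.
Proof.
rewrite hs.unlock.
have E1 n : - n%:Z - 2 = Negz n.+1 by lia.
have E2 n : - n%:Z - 1 = Negz n by lia.
by split=> -[h [n [u [Pu ->]]]]; exists h, n, u; rewrite E1 E2.
Qed.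

Notation O1 := (lspan transl_rels).

Lemma O1_chi c z v : O1 v -> chi c z v = 0.
Proof.
move: v; apply: lspan_ind => [|u v eu ev|x v ev|v /transl_relsE[h [n [u [_ ->]]]]].
- exact: chi0.
- by rewrite chiD eu ev addr0.
- by rewrite chiZ ev mulr0.
by rewrite chiD !chi_neg exprS; ring.
Qed.

Lemma O1_creation h k v : O1 v -> O1 (hs h (Negz k) v).
Proof.
move: v; apply: lspan_ind => [|u v eu ev|x v ev|v /transl_relsE[h' [n [u [Pu ->]]]]].
- by rewrite hs0; exact: lspan0.
- by rewrite hsD; exact: lspanD.
- by rewrite hsZ; exact: lspanZ.
apply: lspan_gen; apply/transl_relsE; exists h', n, (hs h (Negz k) u).
by split; [exact: hs_VP | rewrite hsD !(hs_negC h)].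
Qed.

(** The congruence of h(-n-2) and -h(-n-1) is iterated. *)
Lemma O1_mode h k u : VP K u -> O1 (hs h (Negz k) u - (-1) ^+ k *: hs h (Negz 0) u).
Proof.
move=> Pu; elim: k => [|k IHk]; first by rewrite expr0 scale1r subrr; exact: lspan0.
have -> : hs h (Negz k.+1) u - (-1) ^+ k.+1 *: hs h (Negz 0) u =
   (hs h (Negz k.+1) u + hs h (Negz k) u)
   - (hs h (Negz k) u - (-1) ^+ k *: hs h (Negz 0) u).
  by rewrite opprB [RHS]addrACA subrr addr0 exprS mulN1r scaleNr opprK.
by apply: lspanB => //; apply: lspan_gen; apply/transl_relsE; exists h, k, u.
Qed.

Definition ev1 c : {poly K} -> V :=
  papply (hs (sr true) (Negz 0)) (fun a : K => a *: bv K mset0 c).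

(** The element p(alpha(-1), beta(-1)) e^c, where the outer variable of [p] stands
    for alpha and the inner one for beta. *)
Definition sec c : {poly {poly K}} -> V := papply (hs (sr false) (Negz 0)) (ev1 c).

Let base_add c (a b : K) : (a + b) *: bv K mset0 c = a *: bv K mset0 c + b *: bv K mset0 c.
Proof. exact: scalerDl. Qed.

Lemma ev1D c p q : ev1 c (p + q) = ev1 c p + ev1 c q.
Proof. by apply: papplyD => a b; exact: base_add. Qed.

Lemma ev1C c a : ev1 c a%:P = a *: bv K mset0 c.
Proof. by rewrite /ev1 papplyC // => x y; exact: base_add. Qed.

Lemma ev1X c p : ev1 c ('X * p) = hs (sr true) (Negz 0) (ev1 c p).
Proof. by apply: papplyMX => x y; exact: base_add. Qed.

Lemma secD c p q : sec c (p + q) = sec c p + sec c q.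
Proof. by apply: papplyD; exact: ev1D. Qed.

Lemma secC c p : sec c p%:P = ev1 c p.
Proof. by rewrite /sec papplyC //; exact: ev1D. Qed.

Lemma secX c p : sec c ('X * p) = hs (sr false) (Negz 0) (sec c p).
Proof. by apply: papplyMX; exact: ev1D. Qed.

Lemma secY c p : sec c ('X%:P * p) = hs (sr true) (Negz 0) (sec c p).
Proof.
apply: papply_coef => [|a|v]; [exact: ev1D|exact: ev1X|exact: hs_negC].
Qed.

Lemma ev1Z c a p : ev1 c (a%:P * p) = a *: ev1 c p.
Proof.
by apply: (@papply_coef _ _ _ _ _ (base_add c) (GRing.scale a : V -> V)) => [b|v] /=;
  rewrite ?scalerA // hsZ.
Qed.

Lemma secZ c a p : sec c (a%:P%:P * p) = a *: sec c p.
Proof.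
by apply: (@papply_coef _ _ _ _ _ (@ev1D c) (GRing.scale a : V -> V)) => [b|v] /=;
  rewrite ?ev1Z // hsZ.
Qed.

Lemma chi_sec c z p : chi c z (sec c p) = p.[(z false)%:P].[z true].
Proof.
have base q : chi c z (ev1 c q) = q.[z true].
  elim/poly_ind: q => [|q a IHq].
    by rewrite -[X in ev1 c X](polyC0) ev1C scale0r chi0 horner0.
  rewrite mulrC ev1D ev1C ev1X chiD chi_neg IHq zv_simple chiZ chi_vac.
  by rewrite !hornerE mulrC.
elim/poly_ind: p => [|p q IHp].
  by rewrite -[X in sec c X](polyC0) secC base !horner0.
rewrite mulrC secD secC secX chiD chi_neg IHp zv_simple base expr0 mul1r.
by rewrite !hornerE.
Qed.

Lemma sec1 c : sec c 1 = bv K mset0 c.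
Proof. by rewrite -polyC1 secC -polyC1 ev1C scale1r. Qed.

Lemma sec_fock c p : fock c (sec c p).
Proof.
have base q : fock c (ev1 c q).
  elim/poly_ind: q => [|q a IHq].
    by rewrite -[X in ev1 c X](polyC0) ev1C scale0r; exact: fock0.
  rewrite mulrC ev1D ev1C ev1X; apply: fockD; first exact: hs_fock.
  by apply: fockZ; exact: fock_bv.
elim/poly_ind: p => [|p q IHp].
  by rewrite -[X in sec c X](polyC0) secC; exact: base.
by rewrite mulrC secD secC secX; apply: fockD => //; exact: hs_fock.
Qed.

(** By [O1_mode] every mode can be replaced by a mode of weight one. *)
Lemma normal_form c v : inP c -> fock c v -> exists p, O1 (v - sec c p).
Proof.
move=> cP; move: v; apply: fock_ind => [|u v [p ep] [q eq]|x v [p ep]|].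
- exists 0; rewrite -[X in sec c X](polyC0) secC -polyC0 ev1C scale0r subrr.
  exact: lspan0.
- by exists (p + q); rewrite secD opprD addrACA; exact: lspanD.
- by exists (x%:P%:P * p); rewrite secZ -scalerBr; exact: lspanZ.
apply: modes_ind => [|[i k] m [p ep]].
  by exists 1; rewrite sec1 subrr; exact: lspan0.
have Pm : VP K (bv K m c) by exact: VP_bv.
have [q qE] : exists q, sec c q = hs (sr i) (Negz 0) (sec c p).
  by case: i; [exists ('X%:P * p); exact: secY | exists ('X * p); exact: secX].
exists (((-1) ^+ k)%:P%:P * q); rewrite secZ qE -hs_simple.
have := O1_mode (sr i) k Pm; have := lspanZ ((-1) ^+ k) (O1_creation (sr i) 0 ep).
rewrite hsB scalerBr => e1 e2; have := lspanD e2 e1.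
by rewrite addrA subrK.
Qed.

Lemma poly2_zero (p : {poly {poly K}}) : (forall s t, p.[s%:P].[t] = 0) -> p = 0.
Proof.
move=> p0; have nI : injective (fun n => n%:R : K) by move=> x y /eqP; rewrite eqr_nat => /eqP.
apply: (@poly_infinite_zeros _ (fun n => n%:R%:P)) => [x y /polyC_inj/nI //|n].
by apply: (poly_infinite_zeros nI) => n'.
Qed.

Lemma O1_kernel_fock c v : inP c -> fock c v -> (forall z, chi c z v = 0) -> O1 v.
Proof.
move=> cP fv v0; have [p ep] := normal_form cP fv.
suff p0 : p = 0.
  by move: ep; rewrite p0 -[X in sec c X](polyC0) secC -polyC0 ev1C scale0r subr0.
apply: poly2_zero => s t; pose z i := if i then t else s.
have := O1_chi c z ep; rewrite chiB v0 chi_sec sub0r => /eqP.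
by rewrite oppr_eq0 => /eqP.
Qed.

(** A normal form on which all evaluations vanish is zero, the field being
    infinite. *)
Lemma O1_kernel v : VP K v -> (forall c z, inP c -> chi c z v = 0) -> O1 v.
Proof.
move=> Pv v0; apply: (by_parts (Q := O1)) Pv => [|u u'|c cP].
- exact: lspan0.
- exact: lspanD.
apply: (O1_kernel_fock cP); first exact: fock_proj_fock.
by move=> z; rewrite chi_fock_proj v0.
Qed.

End ModuloTranslation.

(** * Products satisfy the relations *)

Section Relations.
Context (K : numFieldType).
Implicit Types (u v : VA2 K) (h : cartan K) (m : modes) (g c : A2) (z : bool -> K).
Local Notation V := (VA2 K).
Local Notation sr i := (toh K (simple_root i)).

Definition P_roots : seq A2 := [:: alpha; - alpha; beta; alpha + beta].

Definition root_rels : set V := [set x | exists (g : A2) (v : V),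
  [/\ g \in P_roots, fock g v & x = heis (toh K g) (-1) v + v]].

Definition root_sum_rels : set V := [set x | exists (g g' : A2) (v : V),
  [/\ g \in P_roots, g' \in P_roots, g + g' \in [:: alpha + beta; beta], fock (g + g') v
    & x = heis (toh K g) (-1) (heis (toh K g) (-1) v) + heis (toh K g) (-1) v]].

Definition far_rels : set V := [set x | exists g : A2,
  [/\ inP g, g \notin [:: 0; alpha; - alpha; beta; alpha + beta] & fock g x]].

Definition weight0_rels : set V := [set x | exists w : V, fock 0 w /\
  x = heis (toh K alpha) (-1) (heis (toh K alpha) (-1) (heis (toh K alpha) (-1) w))
      - heis (toh K alpha) (-1) w].

Definition relations : set V :=
  transl_rels (K := K) `|` root_rels `|` root_sum_rels `|` far_rels `|` weight0_rels.

Notation W := (lspan relations).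

Lemma O1_W v : lspan (transl_rels (K := K)) v -> W v.
Proof.
move: v; apply: lspan_ind => [|u v|x v|v fv].
- exact: lspan0.
- exact: lspanD.
- exact: lspanZ.
by apply: lspan_gen; do 4 left.
Qed.

Lemma root_rels_W g v : g \in P_roots -> fock g v -> W (hs (toh K g) (Negz 0) v + v).
Proof.
move=> gR fv; apply: lspan_gen; do 3 left; right; exists g, v.
by split=> //; rewrite hs.unlock.
Qed.

Lemma root_sum_rels_W g g' v : g \in P_roots -> g' \in P_roots ->
  g + g' \in [:: alpha + beta; beta] -> fock (g + g') v ->
  W (hs (toh K g) (Negz 0) (hs (toh K g) (Negz 0) v) + hs (toh K g) (Negz 0) v).
Proof.
move=> gR g'R gg fv; apply: lspan_gen; do 2 left; right; exists g, g', v.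
by split=> //; rewrite hs.unlock.
Qed.

Lemma far_rels_W g v : inP g -> g \notin [:: 0; alpha; - alpha; beta; alpha + beta] ->
  fock g v -> W v.
Proof. by move=> gP gn fv; apply: lspan_gen; left; right; exists g. Qed.

Lemma weight0_rels_W v : fock 0 v -> W (hs (sr false) (Negz 0) (hs (sr false) (Negz 0)
  (hs (sr false) (Negz 0) v)) - hs (sr false) (Negz 0) v).
Proof.
by move=> fv; apply: lspan_gen; right; exists v; rewrite hs.unlock.
Qed.

Lemma hs_toh g v : hs (toh K g) (Negz 0) v =
  g.1%:~R *: hs (sr false) (Negz 0) v + g.2%:~R *: hs (sr true) (Negz 0) v.
Proof. by rewrite hsE big_bool addrC. Qed.

Lemma hs_oppalpha v : hs (toh K (- alpha)) (Negz 0) v = - hs (sr false) (Negz 0) v.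
Proof. by rewrite hs_toh /= scaleN1r scale0r addr0. Qed.

Lemma hs_sum_roots v : hs (toh K (alpha + beta)) (Negz 0) v =
  hs (sr false) (Negz 0) v + hs (sr true) (Negz 0) v.
Proof. by rewrite hs_toh /= !scale1r. Qed.

Lemma sec_W_zero p : p.[0] = 0 -> p.[1] = 0 -> p.[-1] = 0 -> W (sec 0 p : V).
Proof.
move=> /eqP/factor_theorem[q1 ->] p1 pm1.
have /eqP/factor_theorem[q2 qE] : q1.[1] = 0.
  by move: p1; rewrite !hornerE subr0 mulr1.
have /eqP/factor_theorem[q q2E] : q2.[-1] = 0.
  move: pm1; rewrite qE !hornerE subr0 => /eqP; rewrite !mulf_eq0.
  have n1 : (-1 : {poly K}) == 0 = false by rewrite oppr_eq0 oner_eq0.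
  have n2 : (-1 - 1 : {poly K}) == 0 = false.
    by rewrite -opprD oppr_eq0 -polyC1 -polyCD polyC_eq0 -[1 + 1]/(2%:R) pnatr_eq0.
  by rewrite n1 n2 !orbF => /eqP.
have -> : q1 * ('X - 0%:P) = 'X * ('X * ('X * q)) + (-1)%:P%:P * ('X * q).
  by rewrite qE q2E !polyC0 !polyCN !polyC1; ring.
rewrite secD secZ !secX scaleN1r; apply: weight0_rels_W; exact: sec_fock.
Qed.

Lemma horner_coefs_zero (q : {poly K}) : (forall t, q.[t] = 0) -> q = 0.
Proof.
move=> q0; apply: (@poly_infinite_zeros _ (fun n => n%:R)) => [x y /eqP|n //].
by rewrite eqr_nat => /eqP.
Qed.

Definition point (s t : K) (i : bool) : K := if i then t else s.

(** The polynomial of [v] is divided by the relations. For [c = 0] and for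
    [c] = alpha, -alpha they are polynomials in alpha alone, with simple roots. For
    the other two roots they form the ideal of two points; the remainder of the
    division by a quadratic in alpha is linear in alpha, and vanishing at the two
    points makes it a multiple of the linear relation. *)
Lemma W_kernel_fock c v : inP c -> fock c v ->
  (forall z, zeros c z -> chi c z v = 0) -> W v.
Proof.
move=> cP fv v0.
have [cn|] := boolP (c \notin [:: 0; alpha; - alpha; beta; alpha + beta]).
  exact: far_rels_W cP cn fv.
have [p ep] := normal_form cP fv.
have ps s t : zeros c (point s t) -> p.[s%:P].[t] = 0.
  move=> /v0; have := O1_chi c (point s t) ep; rewrite chiB => /subr0_eq ->.
  by rewrite chi_sec.
have reduce : W (sec c p) -> W v.
  by move=> Wp; rewrite -[v](subrK (sec c p)); apply: lspanD => //; exact: O1_W.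
rewrite negbK !inE => /or4P[/eqP cE|/eqP cE|/eqP cE|cE]; subst.
- apply: reduce; apply: sec_W_zero; apply: horner_coefs_zero => t.
  + by apply: ps; constructor 1; split=> //; constructor 1.
  + by apply: ps; constructor 1; split=> //; constructor 2.
  + by rewrite -polyCN; apply: ps; constructor 1; split=> //; constructor 3.
- have /eqP/factor_theorem[q qE] : p.[-1] = 0.
    by apply: horner_coefs_zero => t; rewrite -polyCN; apply: ps; constructor 2.
  apply: reduce; have -> : p = 'X * q + q by rewrite qE polyCN polyC1; ring.
  by rewrite secD secX; apply: (@root_rels_W alpha); rewrite ?inE ?eqxx //; exact: sec_fock.
- have /eqP/factor_theorem[q qE] : p.[1] = 0.
    by apply: horner_coefs_zero => t; apply: ps; constructor 3.
  apply: reduce; have -> : p = 'X * q + (-1)%:P%:P * q by rewrite qE polyCN polyC1; ring.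
  rewrite secD secX secZ scaleN1r.
  have H : W (hs (toh K (- alpha)) (Negz 0) (sec (- alpha) q) + sec (- alpha) q).
    by apply: root_rels_W; [rewrite !inE eqxx orbT | exact: sec_fock].
  by have := lspanN H; rewrite opprD hs_oppalpha opprK.
case/orP: cE => /eqP cE; subst.
- have /eqP/factor_theorem[q1 q1E] : (p - p.[0]%:P).[0] = 0 by rewrite !hornerE subrr.
  have /eqP/factor_theorem[r0 r0E] : p.[0].[-1] = 0.
    by apply: ps; constructor 4; left; do 2 split=> //; left.
  have /eqP/factor_theorem[r1 r1E] : q1.[1].[-1] = 0.
    have := ps 1 (-1); have -> : p = q1 * ('X - 0%:P) + p.[0]%:P by rewrite -q1E subrK.
    rewrite !hornerE r0E !hornerE subr0 subrr mulr0 addr0 mulr1; apply.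
    by constructor 4; left; do 2 split=> //; right.
  have /eqP/factor_theorem[q2 q2E] : (q1 - q1.[1]%:P).[1] = 0 by rewrite !hornerE subrr.
  pose w := r1%:P * 'X + r0%:P.
  have pE : p = ('X * ('X * q2) + (-1)%:P%:P * ('X * q2)) + ('X%:P * w + w).
    have -> : p = q1 * ('X - 0%:P) + p.[0]%:P by rewrite -q1E subrK.
    have -> : q1 = q2 * ('X - 1%:P) + q1.[1]%:P by rewrite -q2E subrK.
    by rewrite r0E r1E /w !(polyCM, polyCD, polyCN, polyC1, polyC0); ring.
  apply: reduce; clearbody w; rewrite pE !secD secZ scaleN1r secY !secX; apply: lspanD.
    have H : W (hs (toh K (- alpha)) (Negz 0) (hs (toh K (- alpha)) (Negz 0) (sec beta q2))
        + hs (toh K (- alpha)) (Negz 0) (sec beta q2)).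
      apply: (@root_sum_rels_W _ (alpha + beta)); rewrite ?inE ?eqxx ?orbT //.
      exact: sec_fock.
    by move: H; rewrite !hs_oppalpha (hsN _ _) opprK.
  have H : W (hs (toh K beta) (Negz 0) (sec beta w) + sec beta w).
    by apply: root_rels_W; [rewrite !inE eqxx !orbT | exact: sec_fock].
  exact: H.
have /eqP/factor_theorem[q1 q1E] : (p - p.[0]%:P).[0] = 0 by rewrite !hornerE subrr.
have /eqP/factor_theorem[r0 r0E] : p.[0].[-1] = 0.
  by apply: ps; constructor 4; right; split=> //; left.
have /eqP/factor_theorem[q2 q2E] : (q1 - q1.[-1]%:P).[-1] = 0 by rewrite !hornerE subrr.
have /eqP/factor_theorem[r2 r2E] : (q1.[-1] - r0).[0] = 0.
  have := ps (-1) 0; have -> : p = q1 * ('X - 0%:P) + p.[0]%:P by rewrite -q1E subrK.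
  rewrite polyCN polyC1 !hornerE r0E !hornerE => H; apply: oppr_inj.
  rewrite oppr0 -[RHS]H; first by ring.
  by constructor 4; right; split=> //; right.
pose w1 := q2 - r2%:P; pose w2 := r0%:P + 'X * r2%:P.
have pE : p = ('X * ('X * w1) + 'X * w1) + ('X * w2 + 'X%:P * w2 + w2).
  have -> : p = q1 * ('X - 0%:P) + p.[0]%:P by rewrite -q1E subrK.
  have -> : q1 = q2 * ('X - (-1)%:P) + q1.[-1]%:P by rewrite -q2E subrK.
  have -> : q1.[-1] = r2 * ('X - 0%:P) + r0 by rewrite -r2E subrK.
  by rewrite r0E /w1 /w2 !(polyCM, polyCD, polyCN, polyC1, polyC0); ring.
apply: reduce; clearbody w1 w2; rewrite pE !secD secY !secX; apply: lspanD.
  have H : W (hs (toh K alpha) (Negz 0) (hs (toh K alpha) (Negz 0) (sec (alpha + beta) w1))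
      + hs (toh K alpha) (Negz 0) (sec (alpha + beta) w1)).
    apply: (@root_sum_rels_W _ beta); rewrite ?inE ?eqxx ?orbT //.
    exact: sec_fock.
  exact: H.
have H : W (hs (toh K (alpha + beta)) (Negz 0) (sec (alpha + beta) w2)
    + sec (alpha + beta) w2).
  by apply: root_rels_W; [rewrite !inE eqxx !orbT | exact: sec_fock].
by move: H; rewrite hs_sum_roots.
Qed.

Lemma W_kernel v : VP K v -> (forall c z, zeros c z -> chi c z v = 0) -> W v.
Proof.
move=> Pv v0; apply: (by_parts (Q := W)) Pv => [|u u'|c cP].
- exact: lspan0.
- exact: lspanD.
apply: (W_kernel_fock cP); first exact: fock_proj_fock.
by move=> z cz; rewrite chi_fock_proj v0.
Qed.

Lemma zhuO_sub_relations x : zhuO (@Ymode K) (omega K) (VP K) x -> W x.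
Proof.
move: x; apply: lspan_ind => [|u v|t v|x [k [a [b [Pa ha Pb ->]]]]].
- exact: lspan0.
- exact: lspanD.
- exact: lspanZ.
have aS : supported (fun y => inP y.2 /\ bwt y = k) a.
  by move=> y ya; split; [exact: Pa | exact: homogeneous_supp ha y ya].
move: a aS {Pa ha}; apply: supported_ind => [|u v eu ev|t v ev|m g [/= gP wt]].
- by rewrite circ0l; exact: lspan0.
- by rewrite circDl; exact: lspanD.
- by rewrite circZl; exact: lspanZ.
subst k; move: b Pb; apply: VP_ind => [|u v eu ev|t v ev|m' d dP].
- by rewrite circ0r; exact: lspan0.
- by rewrite circDr; exact: lspanD.
- by rewrite circZr; exact: lspanZ.
have fb : fock d (bv K m' d) by exact: fock_bv.
apply: W_kernel => [|c z cz].
  apply: (@fock_VP K (g + d)); last exact: circ_fock.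
  by move: gP dP; rewrite /inP /=; lia.
exact: circ_vanish fb cz.
Qed.

End Relations.

(** * The relations are products *)

Section GeneratorsInO.
Context (K : numFieldType).
Implicit Types (u v : VA2 K) (h : cartan K) (m : modes) (g d c : A2) (z : bool -> K).
Local Notation V := (VA2 K).
Local Notation sr i := (toh K (simple_root i)).
Local Notation circ := (zhu_circ (@Ymode K)).
Local Notation O := (zhuO (@Ymode K) (omega K) (VP K)).

Lemma O_circ m g b : inP g -> VP K b -> O (circ (bwt (m, g)) (bv K m g) b).
Proof.
move=> gP Pb; apply: lspan_gen; exists (bwt (m, g)), (bv K m g), b.
by split=> //; [exact: VP_bv | exact: homogeneous_bv].
Qed.

Lemma inP0 : inP 0. Proof. by []. Qed.

Lemma half_norm0 : half_norm 0 = 0%N. Proof. by []. Qed.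

(** The mode p of h(-n-1)1 is a multiple of h(p-n) by the binomial coefficient of p
    over n, which vanishes for 0 <= p < n; only p = -2 and p = -1 are left. *)
Lemma circ_single i n u :
  circ (bwt (((i, n) +` mset0)%mset, 0)) (bv K ((i, n) +` mset0)%mset 0) u
  = n.+1%:R *: (hs (sr i) (Negz n.+1) u + hs (sr i) (Negz n) u).
Proof.
have wtE : bwt (((i, n) +` mset0)%mset, 0) = n.+1.
  by rewrite /bwt mode_wt_cons /= half_norm0 /mode_wt /word_wt enum_mset0 big_nil !addn0.
rewrite wtE /zhu_circ; have sE : enum_mset ((i, n) +` mset0)%mset = [:: (i, n)].
  by apply/perm_small_eq => //; apply: (perm_trans (enum_mset_cons _ _)); rewrite enum_mset0.
rewrite big_ord_recl big_ord_recl big1 ?addr0 => [|j _]; last first.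
  rewrite Ymode_bv sE (_ : _ - 2 = Posz j); last by rewrite /= /bump /=; lia.
  by rewrite wmode1_small ?scaler0 //; have := ltn_ord j; lia.
rewrite !Ymode_bv sE /= (_ : 0 - 2 = Negz 1) // (_ : _ - 2 = Negz 0) //.
rewrite !wmode1_neg bin0 scale1r addn0 binn scale1r addn1 bin1.
by rewrite binSn scalerDr.
Qed.

Lemma transl_rels_sub_O v : lspan (transl_rels (K := K)) v -> O v.
Proof.
move: v; apply: lspan_ind => [|u v|x v|v /transl_relsE[h [n [u [Pu ->]]]]].
- exact: lspan0.
- exact: lspanD.
- exact: lspanZ.
rewrite !(hsE h) -big_split; apply: lspan_sum => i _ /=; rewrite -scalerDr; apply: lspanZ.
have := lspanZ n.+1%:R^-1 (O_circ ((i, n) +` mset0)%mset inP0 Pu).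
by rewrite circ_single scalerA mulVf ?pnatr_eq0 // scale1r.
Qed.

(** As the translation relations lie in O, two vectors with the same evaluations
    are in O together. *)
Lemma O_of_chi u v : VP K u -> VP K v -> O u ->
  (forall c z, inP c -> chi c z v = chi c z u) -> O v.
Proof.
move=> Pu Pv Ou uv; rewrite -[v](subrK u); apply: lspanD => //.
apply: transl_rels_sub_O; apply: O1_kernel => [|c z cP].
  by rewrite -scaleN1r; apply: VPD => //; exact: VPZ.
by rewrite chiB uv // subrr.
Qed.

Lemma roots_norm g : g \in P_roots -> half_norm g = 1%N.
Proof. by rewrite !inE => /or4P[]/eqP->. Qed.

Lemma roots_inP g : g \in P_roots -> inP g.
Proof. by rewrite !inE => /or4P[]/eqP->. Qed.

(** The vacuum is annihilated by every annihilation half, so the product has a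
    single term. *)
Lemma chi_vacuum_product c z m g : g \in P_roots ->
  chi c z (circ (bwt (m, g)) (bv K m g) (bv K mset0 0)) =
  (zv z (toh K g) + 1) * chi c z (bv K m g).
Proof.
move=> gR; rewrite chi_circ rho_vacuum /bwt /= (roots_norm gR); last first.
  by rewrite leq_addr.
have kill l : ann g l (shift g (bv K mset0 0)) = if l == 0%N then bv K mset0 g else 0.
  rewrite shift_bv addr0; apply: exp_coef_killed => j; first by rewrite hs0 oppr0.
  by rewrite hs_pos big1 ?oppr0 // => i _; rewrite mset0E mulr0 scale0r.
rewrite (@rho_nil _ _ _ _ 0 _ _ _ 1%N (@fock_bv K mset0 0)); last first.
  by case=> // l _; rewrite kill.
rewrite big_ord1 kill A2form0 /= addKn.
have -> : cocycle K g 0 = 1.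
  by rewrite /cocycle -[(0 : A2).1]/(0 : int) mulr0 expr0z.
rewrite mul1r -[(0 + 0 + 2 - 1)%N]/1%N !chi_bv enum_mset0 big_nil.
have gb1 (x : K) : gb x 1 = x by rewrite /gb big_ord1 subr0 divr1.
by rewrite gb1; case: eqP => _; [rewrite mul1r mulrC | rewrite mul0r !mulr0].
Qed.

Lemma root_rels_sub_O g v : g \in P_roots -> fock g v -> O (hs (toh K g) (Negz 0) v + v).
Proof.
move=> gR; move: v; apply: fock_ind => [|u v eu ev|x v ev|m].
- by rewrite hs0 addr0; exact: lspan0.
- by rewrite hsD addrACA; exact: lspanD.
- by rewrite hsZ -scalerDr; exact: lspanZ.
have gP := roots_inP gR; have Pvac : VP K (bv K mset0 0) by exact: VP_bv.
apply: (O_of_chi _ _ (O_circ m gP Pvac)) => [||c z _].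
- apply: (fock_VP gP); rewrite -{1}[g]addr0; apply: circ_fock; exact: fock_bv.
- by apply: VPD; [apply: hs_VP|]; exact: VP_bv.
by rewrite chi_vacuum_product // chiD chi_neg expr0 mul1r mulrDl mul1r.
Qed.

End GeneratorsInO.

Section BinomialPolynomials.
Context (K : numFieldType).

(** gb (X + 1) n as a polynomial. *)
Definition gbp n : {poly K} :=
  (n`!%:R^-1)%:P * \prod_(i < n) ('X + (1 - i%:R)%:P).

Lemma gbpE n x : (gbp n).[x] = gb (x + 1) n.
Proof.
rewrite /gbp /gb hornerM hornerC horner_prod mulrC; congr (_ * _).
by apply: eq_bigr => i _; rewrite hornerD hornerX hornerC addrA.
Qed.

Lemma size_gbp n : size (gbp n) = n.+1.
Proof.
rewrite /gbp mul_polyC size_scale ?invr_eq0 ?pnatr_eq0 -?lt0n ?fact_gt0 //.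
have -> : \prod_(i < n) ('X + (1 - i%:R)%:P) = \prod_(0 <= i < n) ('X - (i%:R - 1)%:P) :> {poly K}.
  by rewrite big_mkord; apply: eq_bigr => i _; rewrite -polyCN opprB.
by rewrite size_prod_XsubC size_iota subn0.
Qed.

(** The cofactor of the first [n] factors in gb (X + 1) (n + k). *)
Definition gbr n k : {poly K} :=
  (n`!%:R / (n + k)`!%:R)%:P * \prod_(i < k) ('X + (1 - (n + i)%:R)%:P).

Lemma gbp_split n k : gbp (n + k) = gbp n * gbr n k.
Proof.
rewrite /gbp /gbr big_split_ord /= mulrACA; congr (_ * _).
rewrite -polyCM mulrA mulVf ?mul1r // pnatr_eq0 -lt0n; exact: fact_gt0.
Qed.

Lemma size_gbr n k : size (gbr n k) = k.+1.
Proof.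
rewrite /gbr mul_polyC size_scale; last first.
  by rewrite mulf_neq0 ?invr_eq0 // pnatr_eq0 -lt0n fact_gt0.
have -> : \prod_(i < k) ('X + (1 - (n + i)%:R)%:P) =
    \prod_(0 <= i < k) ('X - ((n + i)%:R - 1)%:P) :> {poly K}.
  by rewrite big_mkord; apply: eq_bigr => i _; rewrite -polyCN opprB.
by rewrite size_prod_XsubC size_iota subn0.
Qed.

(** The leading term of [p] is cancelled by a multiple of the member of the same
    degree. *)
Lemma triangular_span (P : {poly K} -> Prop) (q : nat -> {poly K}) : P 0 ->
  (forall p p', P p -> P p' -> P (p + p')) -> (forall a p, P p -> P (a%:P * p)) ->
  (forall k, size (q k) = k.+1) -> (forall k, P (q k)) -> forall p, P p.
Proof.
move=> P0 PD PZ sq Pq p; have [n] := ubnP (size p); elim: n p => // n IHn p.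
have [->|p0] := eqVneq p 0; first by [].
rewrite ltnS => pn; pose k := (size p).-1.
have sp : size p = k.+1 by rewrite prednK // lt0n size_poly_eq0.
have qk0 : q k != 0 by rewrite -size_poly_eq0 sq.
pose a := lead_coef p / lead_coef (q k).
have -> : p = (p - a%:P * q k) + a%:P * q k by rewrite subrK.
apply: (PD); last exact: PZ.
apply: IHn; apply: leq_trans pn; rewrite sp ltnS; apply/leq_sizeP => j.
rewrite leq_eqVlt => /orP[/eqP <-|kj].
  rewrite coefB coefCM.
  have -> : p`_k = lead_coef p by rewrite /lead_coef sp.
  have -> : (q k)`_k = lead_coef (q k) by rewrite /lead_coef sq.
  by rewrite divfK ?subrr // lead_coef_eq0.
by rewrite coefB coefCM !nth_default ?sq ?sp // mulr0 subrr.
Qed.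

End BinomialPolynomials.

Arguments gbz : simpl never.

Section RootResidues.
Context (K : numFieldType).
Implicit Types (u v : VA2 K) (m : modes) (c : A2) (z : bool -> K).
Local Notation V := (VA2 K).
Local Notation circ := (zhu_circ (@Ymode K)).
Local Notation O := (zhuO (@Ymode K) (omega K) (VP K)).

(** The exponential series stops after its linear term when [x] maps [u] to
    multiples of [w] and kills [w]. *)
Lemma exp_coef_once (x : nat -> V -> V) (c : nat -> K) l u w :
  (forall j, x j 0 = 0) -> (forall j a v, x j (a *: v) = a *: x j v) ->
  (forall j, x j.+1 w = 0) -> (forall j, x j.+1 u = c j *: w) ->
  exp_coef x l u = if l is k.+1 then (k.+1%:R^-1 * c k) *: w else u.
Proof.
move=> x0 xZ xw xu.
have p1 k : pow_coef x 1 k.+1 u = (k.+1%:R^-1 * c k) *: w.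
  rewrite /= big_add1 big_mkord big_ord_recr /= subnn eqxx xu scalerA big1 ?add0r //.
  by move=> j _; case: eqP => [E|_]; [have := ltn_ord j; lia | rewrite x0 scaler0].
have p2 r k : pow_coef x r.+2 k u = 0.
  elim: r k => [|r IHr] k.
    rewrite [LHS]/= big_add1 big_mkord big1 // => j _.
    rewrite -[X in x _ X]/(pow_coef x 1 (k - j.+1) u).
    case: (k - j.+1)%N => [|i]; last by rewrite p1 xZ xw !scaler0.
    by rewrite /= big_geq // x0 scaler0.
  rewrite [LHS]/= big1 // => j _.
  by rewrite -[X in x j X]/(pow_coef x r.+2 _ _) IHr x0 scaler0.
case: l => [|k]; first exact: exp_coef0.
rewrite /exp_coef !big_ord_recl big1 ?addr0 => [|r _]; last first.
  by rewrite -[X in _ *: X]/(pow_coef x r.+2 _ _) p2 scaler0.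
rewrite -[X in _ *: X + _]/(0 : V) scaler0 add0r.
by rewrite -[X in _ *: X]/(pow_coef x 1 k.+1 u) p1 invr1 scale1r.
Qed.

Variables (g d : A2).
Hypothesis (g_norm : half_norm g = 1%N) (gP : inP g) (dP : inP d).

(** A vector orthogonal to [g]: its modes commute with those of [g]. *)
Definition orth : A2 := (2 * g.2 - g.1, g.2 - 2 * g.1).

Lemma A2form_orth : A2form g orth = 0.
Proof. by rewrite /A2form /=; case: g => x y /=; ring. Qed.

Lemma A2form_root : A2form g g = 2.
Proof. by rewrite half_normE g_norm. Qed.

Definition hpow c k : V := iter k (hs (toh K orth) (Negz 0)) (bv K mset0 c).

Lemma hpow_killed c k j : hs (toh K g) j.+1 (hpow c k) = 0.
Proof.
elim: k => [|k IHk] /=.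
  by rewrite hs_pos big1 // => i _; rewrite mset0E mulr0 scale0r.
by rewrite hs_comm IHk hs0 add0r hform_toh A2form_orth mulr0 scale0r.
Qed.

Lemma hpow_fock c k : fock c (hpow c k).
Proof. by elim: k => [|k IHk] /=; [exact: fock_bv | exact: hs_fock]. Qed.

Lemma shift_hpow k : shift g (hpow d k) = hpow (g + d) k.
Proof. by elim: k => [|k IHk] /=; [exact: shift_bv | rewrite shift_neg IHk]. Qed.

Lemma chi_hpow c z k : chi c z (hpow c k) = zv z (toh K orth) ^+ k.
Proof.
elim: k => [|k IHk] /=; first exact: chi_vac.
by rewrite chi_neg expr0 mul1r IHk exprS.
Qed.

Lemma ann_hpow c k l : ann g l (hpow c k) = if l == 0%N then hpow c k else 0.
Proof.
by apply: exp_coef_killed => j; rewrite ?hs0 ?hpow_killed oppr0.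
Qed.

Lemma ann_mode_hpow c k n l : ann g l (hs (toh K g) (Negz n) (hpow c k)) =
  if l is j.+1 then (if j == n then -2 else 0) *: hpow c k
  else hs (toh K g) (Negz n) (hpow c k).
Proof.
rewrite /ann (@exp_coef_once _ (fun j => - ((j == n)%:R * j.+1%:R * 2)) _ _ (hpow c k)).
- case: l => // j; congr (_ *: _); case: eqP => _; last by rewrite !mul0r oppr0 mulr0.
  by rewrite mul1r mulrN mulrA mulVf ?mul1r // pnatr_eq0.
- by move=> j; rewrite hs0 oppr0.
- by move=> j a v; rewrite hsZ scalerN.
- by move=> j; rewrite hpow_killed oppr0.
move=> j; rewrite hs_comm hpow_killed hs0 add0r hform_toh A2form_root scaleNr //.
Qed.

(** The vector p(g(-1)) orth(-1)^k e^(g+d) is in O, up to translation relations. *)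
Definition inO k (p : {poly K}) : Prop := exists x, [/\ O x, fock (g + d) x
  & forall z, chi (g + d) z x = p.[zv z (toh K g)] * zv z (toh K orth) ^+ k].

Lemma inO0 k : inO k 0.
Proof.
exists 0; split; [exact: lspan0 | exact: fock0 | move=> z].
by rewrite chi0 horner0 mul0r.
Qed.

Lemma inOD k p p' : inO k p -> inO k p' -> inO k (p + p').
Proof.
move=> [x [Ox fx ex]] [y [Oy fy ey]]; exists (x + y); split.
- exact: lspanD.
- exact: fockD.
- by move=> z; rewrite chiD ex ey hornerD mulrDl.
Qed.

Lemma inOZ k a p : inO k p -> inO k (a%:P * p).
Proof.
move=> [x [Ox fx ex]]; exists (a *: x); split.
- exact: lspanZ.
- exact: fockZ.
- by move=> z; rewrite chiZ ex hornerCM mulrA.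
Qed.

Let coc_neq0 : cocycle K g d != 0.
Proof. by rewrite /cocycle expfz_neq0 // oppr_eq0 oner_eq0. Qed.

Lemma inO_rho k b p : fock d b -> (forall z,
  rho g (g + d) z [::] 1 2%:Z b =
    cocycle K g d * (p.[zv z (toh K g)] * zv z (toh K orth) ^+ k)) -> inO k p.
Proof.
move=> fb E; exists ((cocycle K g d)^-1 *: circ (bwt (mset0, g)) (bv K mset0 g) b); split.
- by apply: lspanZ; apply: O_circ => //; exact: fock_VP fb.
- by apply: fockZ; exact: circ_fock.
move=> z; rewrite chiZ chi_circ enum_mset0 /bwt /= g_norm.
have -> : (mode_wt mset0 + 1)%N = 1%N by rewrite /mode_wt /word_wt enum_mset0 big_nil.
by rewrite E mulrA (mulVf coc_neq0) mul1r.
Qed.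

Definition gbpz (n : int) : {poly K} := if n is Posz k then gbp K k else 0.

Lemma gbpzE n x : (gbpz n).[x] = gbz (x + 1) n.
Proof. by case: n => k /=; rewrite ?gbpE ?horner0. Qed.

(** From the product of e^g with orth(-1)^k e^d. *)
Lemma inO_hpow k : inO k (gbpz (1 - A2form g d)).
Proof.
apply: (inO_rho (@hpow_fock d k)) => z.
rewrite (@rho_nil _ _ _ _ d _ _ _ 1%N (@hpow_fock d k)) => [|[]// l _]; last first.
  by rewrite shift_hpow ann_hpow.
rewrite big_ord1 shift_hpow ann_hpow /= chi_hpow gbpzE; congr (_ * _).
by rewrite mulrC; congr (gbz _ _ * _); lia.
Qed.

(** From the product of e^g with g(-n-1) orth(-1)^k e^d: the mode of [g] either
    survives as a creation operator, or is contracted with e^g to -(g|g) = -2. *)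
Lemma inO_mode_hpow k n : inO k (((-1) ^+ n)%:P * 'X * gbpz (1 - A2form g d)
  + (-2)%:P * gbpz (n%:Z + 2 - A2form g d)).
Proof.
have fb : fock d (hs (toh K g) (Negz n) (hpow d k)).
  by apply: hs_fock; exact: hpow_fock.
apply: (inO_rho fb) => z; rewrite (@rho_nil _ _ _ _ d _ _ _ n.+2 fb); last first.
  case=> // l ln; rewrite shift_neg shift_hpow ann_mode_hpow.
  by case: eqP ln => [->|_ _]; rewrite ?ltnn // scale0r.
rewrite shift_neg shift_hpow big_ord_recl big_ord_recr /=.
rewrite big1 ?add0r => [|l _]; last first.
  rewrite ann_mode_hpow /= ifF ?scale0r ?chi0 ?mul0r //.
  by apply/negP => /eqP; have := ltn_ord l; rewrite /bump; lia.
rewrite !ann_mode_hpow /= /bump /= eqxx chiZ chi_neg chi_hpow; congr (_ * _).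
rewrite hornerD !hornerM !hornerC hornerX !gbpzE mulrDl.
rewrite [RHS]addrC [LHS]addrC; congr (_ + _).
  rewrite [RHS]mulrAC; congr (_ * gbz _ _); lia.
rewrite [RHS]mulrAC; congr (_ * gbz _ _); lia.
Qed.

(** After division by gb (X + 1) n0 the polynomials of [inO_hpow] and
    [inO_mode_hpow] are 1 and one of degree n + 1 for each n. The two terms of the
    latter have the same degree only for n = 0, and then their leading
    coefficients cancel exactly for n0 = 1, that is for (g|d) = 0. *)
Lemma inO_multiples n0 : n0 != 1%N -> A2form g d = 1 - n0%:Z ->
  forall k p, inO k (gbp K n0 * p).
Proof.
move=> n01 gd k; pose q j := if j is n.+1 then
  ((-1) ^+ n)%:P * 'X + (-2)%:P * gbr K n0 n.+1 else 1.
apply: (triangular_span (q := q)) => [|p p'|a p|j|j].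
- by rewrite mulr0; exact: inO0.
- by rewrite mulrDr; exact: inOD.
- by rewrite mulrCA; exact: inOZ.
- case: j => [|n]; first by rewrite size_poly1.
  rewrite /q; case: n => [|n].
    rewrite expr0 polyC1 mul1r /gbr big_ord1 addn0 addn1.
    pose r : K := n0`!%:R / (n0.+1)`!%:R.
    have rE : r = n0.+1%:R^-1.
      by rewrite /r factS natrM invfM mulrCA mulfV ?mulr1 // pnatr_eq0 -lt0n fact_gt0.
    have -> : 'X + (-2)%:P * ((n0`!%:R / n0.+1`!%:R)%:P * ('X + (1 - n0%:R)%:P)) =
        (1 - 2 * r)%:P * 'X + (- 2 * r * (1 - n0%:R))%:P.
      by rewrite -/r !(polyCM, polyCB, polyCN, polyC1); ring.
    rewrite size_MXaddC polyC_eq0 size_polyC.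
    have r0 : 1 - 2 * r != 0.
      rewrite rE subr_eq0; apply/eqP => /(congr1 (fun x => x * n0.+1%:R)).
      rewrite mul1r mulfVK ?pnatr_eq0 // => /eqP; rewrite eqr_nat eqSS.
      by rewrite (negPf n01).
    by rewrite (negPf r0).
  have s2 : size ((-2 : K)%:P * gbr K n0 n.+2) = n.+3.
    by rewrite mul_polyC size_scale ?size_gbr // oppr_eq0 pnatr_eq0.
  rewrite addrC size_polyDl s2 //; apply: leq_ltn_trans (size_polyMleq _ _) _.
  by rewrite size_polyX; have := size_polyC_leq1 ((-1 : K) ^+ n.+1); move: (size _) => s; lia.
case: j => [|n].
  have := inO_hpow k; rewrite gd mulr1 (_ : 1 - (1 - n0%:Z) = n0%:Z) //; lia.
have := inO_mode_hpow k n; rewrite gd (_ : 1 - (1 - n0%:Z) = n0%:Z); last by lia.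
rewrite (_ : n%:Z + 2 - _ = (n0 + n.+1)%:Z); last by lia.
rewrite /gbpz gbp_split mulrDr.
set a := gbp K n0; set b := gbr K n0 n.+1; set e := ((-1) ^+ n)%:P; set f := (-2)%:P.
by have -> : e * 'X * a + f * (a * b) = a * (e * 'X) + a * (f * b) by ring.
Qed.

(** For (g|d) = P + 2 the mode g(-n-1) makes the pole deep enough when n >= P, and
    then gives a polynomial of degree n - P. *)
Lemma inO_all : 2 <= A2form g d -> forall k p, inO k p.
Proof.
move=> gd k; have [P pE] : exists P : nat, A2form g d = P.+2%:Z.
  by exists (absz (A2form g d) - 2)%N; lia.
apply: (triangular_span (q := gbp K)) => [|p p'|a p|j|j].
- exact: inO0.
- exact: inOD.
- exact: inOZ.
- exact: size_gbp.
have := inOZ (-2)^-1 (inO_mode_hpow k (P + j)).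
rewrite pE (_ : 1 - P.+2%:Z = Negz P); last by lia.
rewrite (_ : (P + j)%:Z + 2 - P.+2%:Z = j%:Z); last by lia.
rewrite /gbpz mulr0 add0r mulrA -polyCM mulVf ?mul1r //.
by rewrite oppr_eq0 pnatr_eq0.
Qed.

(** The coordinates of [g] and [orth] have determinant -(g|g) = -2. *)
Lemma point_coords i : exists a b : K, forall z,
  z i = a * zv z (toh K g) + b * zv z (toh K orth).
Proof.
have qE := half_normE g; move: qE; rewrite g_norm /A2form /= => qE.
rewrite /orth; case: (g) qE => x y /= qE.
have {}qE : x%:~R * x%:~R - x%:~R * y%:~R + y%:~R * y%:~R = 1 :> K.
  by rewrite -!rmorphM -rmorphB -rmorphD (_ : _ + _ = 1) //; lia.
case: i.
  exists ((2 * y%:~R - x%:~R) / 2), (- x%:~R / 2) => z.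
  by rewrite !zv_toh /= !(rmorphB, rmorphM) /= -[LHS]mulr1 -[X in _ * X = _]qE; field.
exists ((2 * x%:~R - y%:~R) / 2), (y%:~R / 2) => z.
by rewrite !zv_toh /= !(rmorphB, rmorphM) /= -[LHS]mulr1 -[X in _ * X = _]qE; field.
Qed.

(** Multiplication by a coordinate on h* only changes [k] and [p], so the claim
    reduces from all monomials to e^(g+d). *)
Lemma O_of_multiple B v y : (forall k p, inO k (B * p)) -> fock (g + d) v ->
  fock (g + d) y ->
  (forall z, chi (g + d) z y = B.[zv z (toh K g)] * chi (g + d) z v) -> O y.
Proof.
move=> BO fv fy yE.
suff [x [Ox fx xE]] : exists x, [/\ O x, fock (g + d) x & forall z,
    chi (g + d) z x = B.[zv z (toh K g)] * chi (g + d) z v].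
  have gdP : inP (g + d) by move: gP dP; rewrite /inP /=; lia.
  apply: (@O_of_chi _ x) => // [||c z _]; [exact: fock_VP fx | exact: fock_VP fy|].
  have [->|cn] := eqVneq c (g + d); first by rewrite xE yE.
  by rewrite !(@chi_fock _ c (g + d)) // eq_sym.
move: v fv {y fy yE}; apply: fock_ind => [|u v [x [Ox fx ex]] [y [Oy fy ey]]|a v [x [Ox fx ex]]|m].
- exists 0; split; [exact: lspan0 | exact: fock0 | move=> z].
  by rewrite !chi0 mulr0.
- exists (x + y); split; [exact: lspanD | exact: fockD | move=> z].
  by rewrite !chiD ex ey mulrDr.
- exists (a *: x); split; [exact: lspanZ | exact: fockZ | move=> z].
  by rewrite !chiZ ex mulrCA.
suff /(_ 0%N 1) [x [Ox fx xE]] : forall k p, exists x, [/\ O x, fock (g + d) x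
    & forall z, chi (g + d) z x = B.[zv z (toh K g)] * p.[zv z (toh K g)]
       * zv z (toh K orth) ^+ k * chi (g + d) z (bv K m (g + d))].
  by exists x; split=> // z; rewrite xE hornerC expr0 !mulr1.
move: m; apply: modes_ind => [|[i n] m IHm] k p.
  have [x [Ox fx xE]] := BO k p; exists x; split=> // z.
  by rewrite xE hornerM chi_vac mulr1.
have [x [Ox fx xE]] := IHm k ('X * p); have [y [Oy fy yE]] := IHm k.+1 p.
have [a [b zE]] := point_coords i.
exists ((-1) ^+ n *: (a *: x + b *: y)); split.
- by apply: lspanZ; apply: lspanD; exact: lspanZ.
- by apply: fockZ; apply: fockD; exact: fockZ.
move=> z; rewrite chiZ chiD !chiZ xE yE hornerM hornerX exprS -hs_simple chi_neg.
by rewrite zv_simple (zE z); ring.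
Qed.

End RootResidues.

Section Presentation.
Context (K : numFieldType).
Implicit Types (u v : VA2 K) (g c : A2) (z : bool -> K).
Local Notation V := (VA2 K).
Local Notation O := (zhuO (@Ymode K) (omega K) (VP K)).

Lemma gb2 (x : K) : gb (x + 1) 2 = (x * x + x) / 2.
Proof. by rewrite /gb !big_ord_recl big_ord0 /= /bump /= /factorial /=; field. Qed.

Lemma gb3 (x : K) : gb (x + 1) 3 = (x * (x * x) - x) / 6.
Proof. by rewrite /gb !big_ord_recl big_ord0 /= /bump /= /factorial /=; field. Qed.

Lemma root_sum_form g g' : g \in P_roots -> g' \in P_roots ->
  g + g' \in [:: alpha + beta; beta] -> A2form g g' = -1.
Proof.
by rewrite !inE => /or4P[]/eqP-> /or4P[]/eqP->.
Qed.

Lemma root_sum_rels_sub_O g g' v : g \in P_roots -> g' \in P_roots ->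
  g + g' \in [:: alpha + beta; beta] -> fock (g + g') v ->
  O (hs (toh K g) (Negz 0) (hs (toh K g) (Negz 0) v) + hs (toh K g) (Negz 0) v).
Proof.
move=> gR g'R gg fv; have := root_sum_form gR g'R gg => form.
apply: (@O_of_multiple K g g' _ _ _ (gbp K 2) (2 *: v)) => //.
- exact: roots_norm.
- exact: roots_inP.
- exact: roots_inP.
- apply: inO_multiples => //; [exact: roots_norm|exact: roots_inP|exact: roots_inP].
- exact: fockZ.
- by apply: fockD; [apply: hs_fock|]; exact: hs_fock.
move=> z; rewrite gbpE gb2 chiZ chiD !chi_neg expr0.
move: (chi _ _ v) (zv _ _) => x y; by field.
Qed.

Lemma weight0_rels_sub_O v : fock 0 v -> O (hs (toh K alpha) (Negz 0)
  (hs (toh K alpha) (Negz 0) (hs (toh K alpha) (Negz 0) v)) - hs (toh K alpha) (Negz 0) v).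
Proof.
rewrite -(subrr alpha) => fv.
apply: (@O_of_multiple K alpha (- alpha) _ _ _ (gbp K 3) (6 *: v)) => //.
- exact: inO_multiples.
- exact: fockZ.
- rewrite -scaleN1r; apply: fockD; last by apply: fockZ; exact: hs_fock.
  by do 3! apply: hs_fock.
move=> z; rewrite gbpE gb3 chiZ chiB !chi_neg expr0.
move: (chi _ _ v) (zv _ _) => x y; by field.
Qed.

(** It is enough to find a root g of P with (g|c) >= 3 and c - g in P: outside the
    strip where (alpha|c) is at most 2 in absolute value one of alpha, -alpha
    does, and inside it beta or alpha + beta. *)
Lemma far_decomposition c : inP c ->
  c \notin [:: 0; alpha; - alpha; beta; alpha + beta] ->
  exists g, [/\ g \in P_roots, inP (c - g) & 1 <= A2form g (c - g)].
Proof.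
case: c => x y; rewrite /inP /= => y0 cn.
have n (p r : int) : ((p, r) : A2) \in [:: 0; alpha; - alpha; beta; alpha + beta] ->
    x = p -> y = r -> False.
  by move=> pr xp yr; move: cn; rewrite xp yr pr.
have := n 0 0 isT; have := n 1 0 isT; have := n (-1) 0 isT; have := n 0 1 isT.
have := n 1 1 isT => n1 n2 n3 n4 n5.
have [h1|h1] := lerP 3 (2 * x - y).
  exists alpha; split=> //; first by rewrite /inP /=; lia.
  by rewrite /A2form /=; lia.
have [h2|h2] := lerP 3 (y - 2 * x).
  exists (- alpha); split=> //; first by rewrite /inP /=; lia.
  by rewrite /A2form /=; lia.
have [h3|h3] := lerP 3 (2 * y - x).
  exists beta; split=> //; first by rewrite /inP /=; lia.
  by rewrite /A2form /=; lia.
exists (alpha + beta); split=> //; first by rewrite /inP /=; lia.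
by rewrite /A2form /=; lia.
Qed.

Lemma far_rels_sub_O c v : inP c -> c \notin [:: 0; alpha; - alpha; beta; alpha + beta] ->
  fock c v -> O v.
Proof.
move=> cP cn fv; have [g [gR dP form]] := far_decomposition cP cn.
have gd : g + (c - g) = c by rewrite addrC subrK.
have gN := roots_norm gR; have gP := roots_inP gR.
apply: (@O_of_multiple K g (c - g) _ _ _ 1 v) => //; rewrite ?gd //; last first.
  by move=> z; rewrite hornerC mul1r.
move=> k p; rewrite mul1r; have [form2|form2] := lerP 2 (A2form g (c - g)).
  exact: inO_all.
have form1 : A2form g (c - g) = 1 - 0%N%:Z by lia.
have := @inO_multiples K g (c - g) gN gP dP 0 isT form1 k p.
by rewrite /gbp big_ord0 fact0 invr1 !mul1r.
Qed.

Lemma relations_sub_zhuO x : lspan (relations (K := K)) x -> O x.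
Proof.
move: x; apply: lspan_ind => [|u v|t v|v].
- exact: lspan0.
- exact: lspanD.
- exact: lspanZ.
case=> [[[[f1|[g [u [gR fu ->]]]]|[g [g' [u [gR g'R gg fu ->]]]]]|[g [gP gn fv]]]|[u [fu ->]]].
- by apply: transl_rels_sub_O; exact: lspan_gen.
- by have := root_rels_sub_O gR fu; rewrite hs.unlock.
- by have := root_sum_rels_sub_O gR g'R gg fu; rewrite hs.unlock.
- exact: far_rels_sub_O gP gn fv.
- by have := weight0_rels_sub_O fu; rewrite hs.unlock.
Qed.

End Presentation.

Theorem theoremC (R : realType) :
  zhuO (@Ymode R[i]) (omega R[i]) (VP R[i]) =
  lspan (
    [set x | exists (h : cartan R[i]) (n : nat) (u : VA2 R[i]),
       VP R[i] u /\ x = heis h (- n%:Z - 2) u + heis h (- n%:Z - 1) u]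
    `|`
    [set x | exists (g : A2) (v : VA2 R[i]),
       [/\ g \in [:: alpha; - alpha; beta; alpha + beta], fock g v
         & x = heis (toh R[i] g) (-1) v + v]]
    `|`
    [set x | exists (g g' : A2) (v : VA2 R[i]),
       [/\ g \in [:: alpha; - alpha; beta; alpha + beta],
           g' \in [:: alpha; - alpha; beta; alpha + beta],
           g + g' \in [:: alpha + beta; beta], fock (g + g') v
         & x = heis (toh R[i] g) (-1) (heis (toh R[i] g) (-1) v)
               + heis (toh R[i] g) (-1) v]]
    `|`
    [set x | exists g : A2,
       [/\ inP g, g \notin [:: 0; alpha; - alpha; beta; alpha + beta]
         & fock g x]]
    `|`
    [set x | exists w : VA2 R[i],
       fock 0 w /\
       x = heis (toh R[i] alpha) (-1) (heis (toh R[i] alpha) (-1)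
             (heis (toh R[i] alpha) (-1) w)) - heis (toh R[i] alpha) (-1) w]).
Proof.
apply/seteqP; split=> x.
  exact: zhuO_sub_relations.
exact: relations_sub_zhuO.
Qed.
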